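(* Let $1 \le p \le \infty$, and equip $\operatorname{Lip}[0,1]$ with the norm $\|\cdot\|_{\sigma,p}$. Let $\Delta \colon S^+_{\operatorname{Lip},p} \to S^+_{\operatorname{Lip},p}$ be a surjective isometry. Then there exists a surjective complex-linear isometry $T \colon \operatorname{Lip}[0,1] \to \operatorname{Lip}[0,1]$ such that $T|_{S^+_{\operatorname{Lip},p}} = \Delta$. Moreover, $T$ is represented as $$T(f)(t) = f(0) + \int_0^t \Lambda(f')(x)\,dx \qquad (f \in \operatorname{Lip}[0,1],\ t \in [0,1]),$$ where $\Lambda \colon L^\infty[0,1] \to L^\infty[0,1]$ is an isometric $\ast$-isomorphism. Furthermore, there exists a homeomorphism $\tau \colon \mathcal{M} \to \mathcal{M}$ such that $$\Lambda(u) = \Gamma^{-1}(\Gamma(u) \circ \tau) \qquad (u \in L^\infty[0,1]),$$ where $\mathcal{M}$ and $\Gamma \colon L^\infty[0,1] \to C(\mathcal{M})$ stand for the maximal ideal space and the Gelfand transform of $L^\infty[0,1]$, respectively.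
   Context: $\operatorname{Lip}[0,1]$ is the space of all Lipschitz continuous complex-valued functions on $[0,1]$. Every $f \in \operatorname{Lip}[0,1]$ is differentiable almost everywhere with $f' \in L^\infty[0,1]$ (Lebesgue measure, complex-valued), and $\|f'\|_\infty$ denotes the essential supremum norm. The norm is $\|f\|_{\sigma,p} = (|f(0)|^p + \|f'\|_\infty^p)^{1/p}$ for $1 \le p < \infty$ and $\|f\|_{\sigma,\infty} = \max\{|f(0)|, \|f'\|_\infty\}$. $\operatorname{Lip}_{\mathbb{R}}[0,1]$ is the real subspace of real-valued functions in $\operatorname{Lip}[0,1]$, ordered by: $f \le g$ if and only if $f(0) \le g(0)$ and $f' \le g'$ almost everywhere on $[0,1]$. The positive part of the unit sphere is $S^+_{\operatorname{Lip},p} = \{ f \in \operatorname{Lip}_{\mathbb{R}}[0,1] : \|f\|_{\sigma,p} = 1,\ f \ge 0\}$, where $f\ge 0$ refers to this order. $C(\mathcal{M})$ is the space of continuous complex-valued functions on the compact Hausdorff space $\mathcal{M}$ with the supremum norm. A map $\Delta$ between subsets of normed spaces is an isometry if $\|\Delta(f) - \Delta(g)\| = \|f-g\|$ for all $f,g$ in its domain (no linearity is assumed). *)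

(* Defs.v *)
From HB Require Import structures.
From mathcomp Require Import all_boot all_order all_algebra.
From mathcomp Require Import all_classical all_reals all_analysis.
From mathcomp Require Import ess_sup_inf ring_quotient complex.

Set Implicit Arguments.
Unset Strict Implicit.
Unset Printing Implicit Defensive.

Import Order.TTheory GRing.Theory Num.Theory.
Import numFieldNormedType.Exports.

Local Open Scope classical_set_scope.
Local Open Scope complex_scope.
Local Open Scope quotient_scope.
Local Open Scope ring_scope.

Section Linfty.
Context (R : realType).

(* A measure on the whole of R that ignores the complement of [0,1]. *)
Definition leb01 : {measure set (measurableTypeR R) -> \bar R} :=
  mrestr (@lebesgue_measure R) (measurable_itv `[(0 : R), 1]).

#[global] Instance leb01_ae_filter : Filter (almost_everywhere leb01).
Proof. exact: ae_filter_ringOfSetsType. Qed.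

Definition Cmeasurable01 (u : R -> R[i]) : Prop :=
  measurable_fun `[(0 : R), 1] (fun x => complex.Re (u x)) /\
  measurable_fun `[(0 : R), 1] (fun x => complex.Im (u x)).

Definition ess_bounded01 (u : R -> R[i]) : Prop :=
  exists M : R, {ae leb01, forall x, Normc.normc (u x) <= M}.

(* Values outside [0,1] are irrelevant, since leb01 does not see them. *)
Definition Linf_fun : {pred R -> R[i]} :=
  fun u => `[< Cmeasurable01 u /\ ess_bounded01 u >].

Lemma Linf_fun_subring : subring_closed Linf_fun.
Proof.
have ReD (x y : R[i]) : complex.Re (x - y) = complex.Re x - complex.Re y by case: x y => [? ?] [? ?].
have ImD (x y : R[i]) : complex.Im (x - y) = complex.Im x - complex.Im y by case: x y => [? ?] [? ?].
have ReM (x y : R[i]) : complex.Re (x * y) = complex.Re x * complex.Re y - complex.Im x * complex.Im y.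
  by case: x y => [? ?] [? ?].
have ImM (x y : R[i]) : complex.Im (x * y) = complex.Re x * complex.Im y + complex.Im x * complex.Re y.
  by case: x y => [? ?] [? ?].
split.
- apply/asboolP; split; first by split; exact: measurable_cst.
  exists 1; apply: aeW => x.
  by have -> : (1 : R -> R[i]) x = 1 by []; rewrite Normc.normc1.
- move=> u v /asboolP[[mu1 mu2] [M Mu]] /asboolP[[mv1 mv2] [N Nv]].
  apply/asboolP; split.
    split.
      rewrite (funext (fun x => ReD (u x) (v x))).
      exact: measurable_realfun.measurable_funB.
    rewrite (funext (fun x => ImD (u x) (v x))).
    exact: measurable_realfun.measurable_funB.
  exists (M + N); apply: (filterS2 _ _ Mu Nv) => x ux vx.
  apply: le_trans (le_normcD (u x : Rcomplex R) (- v x)) _.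
  by rewrite (normcN (v x : Rcomplex R)) lerD.
- move=> u v /asboolP[[mu1 mu2] [M Mu]] /asboolP[[mv1 mv2] [N Nv]].
  apply/asboolP; split.
    split.
      rewrite (funext (fun x => ReM (u x) (v x))).
      by apply: measurable_realfun.measurable_funB;
        exact: measurable_realfun.measurable_funM.
    rewrite (funext (fun x => ImM (u x) (v x))).
    by apply: measurable_realfun.measurable_funD;
      exact: measurable_realfun.measurable_funM.
  exists (M * N); apply: (filterS2 _ _ Mu Nv) => x ux vx.
  by rewrite Normc.normcM ler_pM//; exact: (normr_ge0 (_ : Rcomplex R)).
Qed.

HB.instance Definition _ :=
  GRing.isSubringClosed.Build (R -> R[i]) Linf_fun Linf_fun_subring.

Lemma Linf_fun_cst (c : R[i]) : (fun=> c) \in Linf_fun.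
Proof.
apply/asboolP; split; first by split; exact: measurable_cst.
by exists (Normc.normc c); apply: aeW => x.
Qed.

Lemma Linf_fun_conj (u : R -> R[i]) :
  u \in Linf_fun -> (fun x => conjc (u x)) \in Linf_fun.
Proof.
have ReC (x : R[i]) : complex.Re (conjc x) = complex.Re x by case: x.
have ImC (x : R[i]) : complex.Im (conjc x) = - complex.Im x by case: x.
move=> /asboolP[[mu1 mu2] [M Mu]]; apply/asboolP; split.
  split; first by rewrite (funext (fun x => ReC (u x))).
  rewrite (funext (fun x => ImC (u x))).
  exact: measurable_realfun.measurable_funN.
exists M; apply: (filterS _ Mu) => x; case: (u x) => a b /=.
by rewrite sqrrN.
Qed.

Record LinfFun := MkLinfFun {
  Linf_val :> R -> R[i];
  Linf_valP : Linf_val \in Linf_fun }.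

HB.instance Definition _ := [isSub for Linf_val].
HB.instance Definition _ := [Choice of LinfFun by <:].
HB.instance Definition _ := [SubChoice_isSubComNzRing of LinfFun by <:].

Definition ae_null : {pred LinfFun} :=
  fun u => `[< {ae leb01, forall x, u x = 0} >].

Lemma leb01_setT : leb01 setT = 1%E.
Proof.
rewrite /leb01/= /mrestr setTI lebesgue_measure_itv/=.
by rewrite lte01 oppr0 adde0.
Qed.

Lemma ae_null_ideal : idealr_closed ae_null.
Proof.
split.
- by apply/asboolP; apply: aeW.
- apply/negP => /asboolP/= [A [mA A0 sA]].
  suff AT : A = setT by move: A0; rewrite AT leb01_setT => /eqP; rewrite onee_eq0.
  apply/seteqP; split => // x _; apply: sA => /= x0.
  by have /eqP : (1 : R[i]) = 0 := x0; rewrite oner_eq0.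
- move=> a u v /asboolP ux /asboolP vx; apply/asboolP.
  apply: (filterS2 _ _ ux vx) => x u0 v0.
  by have -> : (a * u + v) x = a x * u x + v x by []; rewrite u0 v0 mulr0 addr0.
Qed.

HB.instance Definition _ := isIdealr.Build LinfFun ae_null ae_null_ideal.

Definition Linf : Type := {ideal_quot ae_null}.
HB.instance Definition _ := GRing.ComNzRing.on Linf.
HB.instance Definition _ := EqQuotient.on Linf.

Definition Linf_cst (c : R[i]) : Linf := \pi_Linf (MkLinfFun (Linf_fun_cst c)).

Lemma Linf_cst_is_zmod_morphism : zmod_morphism Linf_cst.
Proof.
move=> a b; rewrite /Linf_cst -[RHS](rmorphB (\pi_Linf)).
by congr (\pi _); exact: val_inj.
Qed.

Lemma Linf_cst_is_monoid_morphism : monoid_morphism Linf_cst.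
Proof.
split; first by rewrite -[RHS](rmorph1 (\pi_Linf)); congr (\pi _); exact: val_inj.
move=> a b; rewrite /Linf_cst -[RHS](rmorphM (\pi_Linf)).
by congr (\pi _); exact: val_inj.
Qed.

HB.instance Definition _ :=
  GRing.isZmodMorphism.Build R[i] Linf Linf_cst Linf_cst_is_zmod_morphism.
HB.instance Definition _ :=
  GRing.isMonoidMorphism.Build R[i] Linf Linf_cst Linf_cst_is_monoid_morphism.

(* Scaling by c is multiplication by the class of the constant function c. *)
Definition Linf_scale (c : R[i]) (u : Linf) : Linf := Linf_cst c * u.

Lemma Linf_scaleA a b u : Linf_scale a (Linf_scale b u) = Linf_scale (a * b) u.
Proof. by rewrite /Linf_scale rmorphM mulrA. Qed.

Lemma Linf_scale1 : left_id 1 Linf_scale.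
Proof. by move=> u; rewrite /Linf_scale rmorph1 mul1r. Qed.

Lemma Linf_scaleDr : right_distributive Linf_scale +%R.
Proof. by move=> a u v; rewrite /Linf_scale mulrDr. Qed.

Lemma Linf_scaleDl u : {morph Linf_scale^~ u : a b / a + b}.
Proof. by move=> a b; rewrite /Linf_scale rmorphD mulrDl. Qed.

HB.instance Definition _ := GRing.Zmodule_isLmodule.Build R[i] Linf
  Linf_scaleA Linf_scale1 Linf_scaleDr Linf_scaleDl.

Lemma Linf_scaleAl (c : R[i]) (u v : Linf) : c *: (u * v) = (c *: u) * v.
Proof. exact: mulrA. Qed.

HB.instance Definition _ :=
  GRing.Lmodule_isLalgebra.Build R[i] Linf Linf_scaleAl.

Lemma Linf_scaleAr (c : R[i]) (u v : Linf) : c *: (u * v) = u * (c *: v).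
Proof. by rewrite mulrC Linf_scaleAl mulrC. Qed.

HB.instance Definition _ :=
  GRing.Lalgebra_isAlgebra.Build R[i] Linf Linf_scaleAr.

Definition Linf_conj (u : Linf) : Linf :=
  \pi_Linf (MkLinfFun (Linf_fun_conj (Linf_valP (repr u)))).

Definition Linf_norm (u : Linf) : R :=
  fine (ess_sup leb01 (fun x => (Normc.normc (repr u x))%:E)).

(* The order of R[i]: equal imaginary parts and ordered real parts; it is used
   on classes of real-valued functions only. *)
Definition Linf_le (u v : Linf) : Prop :=
  {ae leb01, forall x, repr u x <= repr v x}.

Definition isometric_star_isomorphism (Lambda : Linf -> Linf) : Prop :=
  [/\ bijective Lambda, linear Lambda,
      {morph Lambda : u v / u * v},
      {morph Lambda : u / Linf_conj u} &
      forall u, Linf_norm (Lambda u) = Linf_norm u].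

End Linfty.

Section Gelfand.
Context (R : realType).

(* Maximal ideals of a commutative Banach algebra are identified, as kernels,
   with its characters: the nonzero multiplicative linear functionals. *)
Definition character (phi : Linf R -> R[i]^o) : Prop :=
  [/\ linear phi, {morph phi : u v / u * v} & exists u, phi u != 0].

(* The Gelfand topology is the topology of pointwise convergence. *)
Definition max_ideal_space : Type :=
  [set phi : {ptws Linf R -> R[i]^o} | character phi].
HB.instance Definition _ := Topological.on max_ideal_space.

Lemma gelfand_continuous (u : Linf R) :
  continuous (fun phi : max_ideal_space => set_val phi u).
Proof.
move=> phi.
apply: (@continuous_comp _ _ _ set_val (fun f : {ptws Linf R -> R[i]^o} => f u)).
  exact: initial_continuous.
exact: proj_continuous.
Qed.

Definition gelfand (u : Linf R) : continuousType max_ideal_space R[i]^o :=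
  mkcts (@gelfand_continuous u).

(* Gelfand-Naimark: gelfand is a bijection, so this is its genuine inverse and
   the default value 0 is never used. *)
Definition gelfand_inv :
    continuousType max_ideal_space R[i]^o -> Linf R :=
  'pinv_(fun=> 0) [set: Linf R] gelfand.

Definition homeomorphism (X Y : topologicalType) (f : X -> Y) : Prop :=
  continuous f /\ exists g, [/\ continuous g, cancel f g & cancel g f].

End Gelfand.

Section Lipschitz.
Context (R : realType).

Definition I01 : Type := `[(0 : R), 1]%classic.

Definition Lip_fun : {pred I01 -> R[i]} :=
  fun f => `[< exists L : R, forall x y,
    Normc.normc (f x - f y) <= L * `|val x - val y| >].

Lemma Lip_fun_submod : submod_closed Lip_fun.
Proof.
split.
  apply/asboolP; exists 0 => x y.
  by rewrite subrr Normc.normc0 mul0r.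
move=> a f g /asboolP[L Lf] /asboolP[M Mg]; apply/asboolP.
exists (Normc.normc a * L + M) => x y.
have -> : (a *: f + g) x - (a *: f + g) y = a * (f x - f y) + (g x - g y).
  have E z : (a *: f + g) z = a * f z + g z by [].
  by rewrite !E mulrBr opprD addrACA.
apply: le_trans (le_normcD (_ : Rcomplex R) _) _.
rewrite Normc.normcM mulrDl -mulrA lerD// ler_wpM2l//.
exact: (normr_ge0 (a : Rcomplex R)).
Qed.

HB.instance Definition _ :=
  GRing.isSubmodClosed.Build R[i] (I01 -> R[i]) Lip_fun Lip_fun_submod.

Record Lip := MkLip {
  Lip_val :> I01 -> R[i];
  Lip_valP : Lip_val \in Lip_fun }.

HB.instance Definition _ := [isSub for Lip_val].
HB.instance Definition _ := [Choice of Lip by <:].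
HB.instance Definition _ := [SubChoice_isSubLmodule of Lip by <:].

Lemma I01_0_subproof : (0 : R) \in `[(0 : R), 1]%classic.
Proof. by rewrite inE /= in_itv /= lexx ler01. Qed.

Definition I01_0 : I01 := exist _ 0 I01_0_subproof.

(* The derivative at interior points: f is extended by 0 outside [0,1], and
   real and imaginary parts are differentiated separately. *)
Definition has_derivative (f : Lip) (x : R) (z : R[i]) : Prop :=
  let F := 'valL_ 0 f in
  is_derive x (1 : R) (fun y => complex.Re (F y)) (complex.Re z) /\
  is_derive x (1 : R) (fun y => complex.Im (F y)) (complex.Im z).

(* The class f' in L^oo of the a.e. derivative; existence is Rademacher's
   theorem, uniqueness is that of derivatives, so 0 is never used. *)
Definition Lip_deriv (f : Lip) : Linf R :=
  xget 0 [set u : Linf R | {ae leb01 R, forall x, has_derivative f x (repr u x)}].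

Definition sigma_norm (p : \bar R) (f : Lip) : R :=
  let a := Normc.normc (f I01_0) in
  let b := Linf_norm (Lip_deriv f) in
  match p with
  | r%:E => (a `^ r + b `^ r) `^ r^-1
  | +oo%E => Num.max a b
  | -oo%E => 0 (* excluded by 1 <= p *)
  end.

Definition Lip_real (f : Lip) : Prop := forall x, complex.Im (f x) = 0.

(* Meant for f and g in Lip_real. *)
Definition Lip_le (f g : Lip) : Prop :=
  f I01_0 <= g I01_0 /\ Linf_le (Lip_deriv f) (Lip_deriv g).

Definition pos_sphere (p : \bar R) : set Lip :=
  [set f | [/\ Lip_real f, sigma_norm p f = 1 & Lip_le 0 f]].

Definition Cintegral_from0 (t : R) (u : R -> R[i]) : R[i] :=
  (\int[@lebesgue_measure R]_(x in `[0, t]) complex.Re (u x)) +i*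
  (\int[@lebesgue_measure R]_(x in `[0, t]) complex.Im (u x)).

End Lipschitz.

(* Main.v *)
Require Import Defs.
From HB Require Import structures.
From mathcomp Require Import all_boot all_order all_algebra.
From mathcomp Require Import all_classical all_reals all_analysis.
From mathcomp Require Import ess_sup_inf ring_quotient complex measurable_realfun.
From mathcomp Require Import ring lra.
Import Order.TTheory GRing.Theory Num.Theory.
Import numFieldNormedType.Exports.
Local Open Scope classical_set_scope.
Local Open Scope complex_scope.
Local Open Scope ring_scope.

(** Write B for the positive unit ball of L^oo[0,1], the classes u with
    0 <= u <= 1 almost everywhere.

    A Lipschitz function is the primitive of its derivative, and every class in
    L^oo is the derivative of its primitive, so that f |-> (f(0), f') is a
    linear bijection onto C x L^oo ([Lip_eq_Iprim], [Lip_deriv_Iprim]).  The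
    density of a K-Lipschitz function f comes from the Radon-Nikodym theorem
    applied to the Stieltjes measure of K x + f(x), which is at most 2 K times
    the Lebesgue measure ([lipschitz_density]), and the Lebesgue differentiation
    theorem identifies it with f' ([prim_derive]).

    In these coordinates the positive unit sphere consists of pairs (a, u) with
    a >= 0 and u in B, and a surjective isometry has the form
    (a, u) |-> (a, Phi u), where Phi is a surjective isometry of B fixing 0
    ([sphere_reduction]).  For p < oo the point (1, 0) is fixed since it is the
    common point of all pairs at the maximal distance 2^(1/p); the distance to it
    determines a, and u determines a, so that Delta acts on the second
    coordinates.  For p = oo the point (1, 0) is recognised by the way in which
    open balls of radius 1 meet, which uses that the Lebesgue measure has no
    atoms; the points (1, u) are then permuted and give Phi, and the points
    (a, u) with a < 1 are recovered from their distances to points already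
    known.

    Such a Phi is the restriction of a *-automorphism of L^oo
    ([ball_isometry_extend]).  The order of B can be read off its metric: the
    balls of radius 1/2 containing 0 and v all contain u exactly when
    u <= max(v, 1/2), and dually with 1 in place of 0 ([ae_le_dist_char]).
    Hence Phi preserves the order, the constants, and the idempotents, which are
    the complemented elements of B.  For every monotone 1-Lipschitz phi on the
    unit square, phi(u, v) is the least upper bound of the elements phi(t, s) e
    with e idempotent, t e <= u and s e <= v, so that Phi commutes with phi
    acting pointwise ([ball_isometry_op]).  The cases phi(a, b) = (a + b)/2 and
    phi(a, b) = a b make Phi additive and multiplicative.  Complex-linear
    extension is then formal, and it is isometric since |u| <= r means that
    r^2 - u u^* is nonnegative.

    Finally Lambda acts on characters by composition, which gives tau.  The
    formula for Lambda in terms of tau only needs that the Gelfand transform is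
    injective: for u <> 0, the limit along an ultrafilter that contains the
    conull sets and a set on which |u| is bounded below is a character that
    does not vanish at u ([exists_character]). *)

(** * Almost-everywhere calculus on classes of bounded functions *)

(** P holds for almost every x in [0,1], where x is bound as a real number. *)
Notation "'AE' x ':' R , P" := {ae leb01 R, forall x : R, P}
  (at level 200, x name, R at level 0, P at level 200, only parsing).

Section LinfAlmostEverywhere.
Context {R : realType}.
Local Notation L := (Linf R).
Implicit Types u v w : L.

Lemma filterS4 {T} {F : set (set T)} {FF : Filter F} (P1 P2 P3 P4 Q : set T) :
  (forall x, P1 x -> P2 x -> P3 x -> P4 x -> Q x) ->
  F P1 -> F P2 -> F P3 -> F P4 -> F Q.
Proof.
move=> H H1 H2 H3 H4; apply: (filterS2 _ _ (filterI H1 H2) (filterI H3 H4)).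
by move=> x [? ?] [? ?]; exact: H.
Qed.

Lemma filterS5 {T} {F : set (set T)} {FF : Filter F} (P1 P2 P3 P4 P5 Q : set T) :
  (forall x, P1 x -> P2 x -> P3 x -> P4 x -> P5 x -> Q x) ->
  F P1 -> F P2 -> F P3 -> F P4 -> F P5 -> F Q.
Proof.
move=> H H1 H2 H3 H4 H5.
apply: (filterS3 _ _ (filterI H1 H2) (filterI H3 H4) H5).
by move=> x [? ?] [? ?] ?; exact: H.
Qed.

(** The representative of the class of g agrees with g almost everywhere. *)
Lemma repr_pi (g : LinfFun R) : AE x : R, repr (\pi_L%qT g) x = g x.
Proof.
have : (repr (\pi_L%qT g) - g) \in ae_null (R := R).
  by rewrite Quotient.idealrBE reprK.
move=> /asboolP; apply: filterS => x /eqP.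
by rewrite subr_eq0 => /eqP.
Qed.

Lemma Linf_eqP u v : u = v <-> AE x : R, repr u x = repr v x.
Proof.
split=> [->|H]; first exact: aeW.
rewrite -(reprK u) -(reprK v); apply/eqP; rewrite -Quotient.idealrBE.
apply/asboolP; apply: filterS H => x /eqP.
by rewrite -subr_eq0 => /eqP.
Qed.

Lemma Linf_reprD u v : AE x : R, repr (u + v) x = repr u x + repr v x.
Proof.
have -> : u + v = \pi_L%qT (repr u + repr v).
  by rewrite rmorphD /= !reprK.
exact: repr_pi.
Qed.

Lemma Linf_reprN u : AE x : R, repr (- u) x = - repr u x.
Proof.
have -> : - u = \pi_L%qT (- repr u) by rewrite rmorphN /= !reprK.
exact: repr_pi.
Qed.

Lemma Linf_reprB u v : AE x : R, repr (u - v) x = repr u x - repr v x.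
Proof. by apply: filterS2 (Linf_reprD u (- v)) (Linf_reprN v) => x -> ->. Qed.

Lemma Linf_reprM u v : AE x : R, repr (u * v) x = repr u x * repr v x.
Proof.
have -> : u * v = \pi_L%qT (repr u * repr v).
  by rewrite rmorphM /= !reprK.
exact: repr_pi.
Qed.

Lemma Linf_repr_cst c : AE x : R, repr (Linf_cst c) x = c.
Proof. exact: repr_pi. Qed.

Lemma Linf_repr0 : AE x : R, repr (0 : L) x = 0.
Proof. by rewrite -(rmorph0 (@Linf_cst R)); exact: Linf_repr_cst. Qed.

Lemma Linf_repr1 : AE x : R, repr (1 : L) x = 1.
Proof. by rewrite -(rmorph1 (@Linf_cst R)); exact: Linf_repr_cst. Qed.

Lemma Linf_scaleE c u : c *: u = Linf_cst c * u.
Proof. by []. Qed.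

Lemma Linf_reprZ c u : AE x : R, repr (c *: u) x = c * repr u x.
Proof.
rewrite Linf_scaleE.
by apply: filterS2 (Linf_reprM (Linf_cst c) u) (Linf_repr_cst c) => x -> ->.
Qed.

Lemma Linf_repr_conj u : AE x : R, repr (Linf_conj u) x = conjc (repr u x).
Proof. exact: repr_pi. Qed.

Lemma leb01_gt0 : (0 < leb01 R setT)%E.
Proof. by rewrite leb01_setT lte01. Qed.

(** The measure is not zero and the class is essentially bounded, so taking the
    finite part in the definition of the norm loses nothing. *)
Lemma Linf_ess_sup_fin u :
  ess_sup (leb01 R) (fun x => (Normc.normc (repr u x))%:E) \is a fin_num.
Proof.
have /asboolP[_ [M HM]] := Linf_valP (repr u).
rewrite fin_numE; apply/andP; split; apply/eqP => H.
  have : (0 <= ess_sup (leb01 R) (fun x => (Normc.normc (repr u x))%:E))%E.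
    apply: ess_sup_gee; first exact: leb01_gt0.
    apply: aeW => x; rewrite lee_fin.
    exact: (normr_ge0 (repr u x : Rcomplex R)).
  by rewrite H.
have : (ess_sup (leb01 R) (fun x => (Normc.normc (repr u x))%:E) <= M%:E)%E.
  by apply/ess_supP; apply: filterS HM => x; rewrite lee_fin.
by rewrite H.
Qed.

Lemma Linf_norm_le u r :
  Linf_norm u <= r <-> AE x : R, Normc.normc (repr u x) <= r.
Proof.
rewrite /Linf_norm -lee_fin fineK ?Linf_ess_sup_fin//.
by split=> [/ess_supP|H]; [|apply/ess_supP]; [|move: H];
  apply: filterS => x; rewrite lee_fin.
Qed.

(** The measure is not zero, so a property true almost everywhere is true somewhere. *)
Lemma ae_exists (P : R -> Prop) : {ae leb01 R, forall x, P x} -> exists x, P x.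
Proof.
move=> [A [mA A0 HA]]; apply: contrapT => /forallNP nP.
suff AT : A = setT.
  by move: A0; rewrite AT leb01_setT => /eqP; rewrite onee_eq0.
by apply/seteqP; split => // x _; apply: HA => /= Px; exact: nP Px.
Qed.

Lemma Linf_norm_ge0 u : 0 <= Linf_norm u.
Proof.
have [x Hx] := ae_exists _ ((Linf_norm_le u _).1 (lexx _)).
by apply: le_trans Hx; exact: (normr_ge0 (repr u x : Rcomplex R)).
Qed.

Lemma Linf_norm0 : Linf_norm (0 : L) = 0.
Proof.
apply/eqP; rewrite eq_le Linf_norm_ge0 andbT; apply/Linf_norm_le.
by apply: filterS Linf_repr0 => x ->; rewrite Normc.normc0.
Qed.

Lemma Linf_norm0_eq u : Linf_norm u = 0 -> u = 0.
Proof.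
move=> u0; apply/Linf_eqP.
have H : Linf_norm u <= 0 by rewrite u0.
apply: filterS2 ((Linf_norm_le _ _).1 H) Linf_repr0 => x ux ->.
by apply: Normc.eq0_normc; apply/eqP; rewrite eq_le ux
  (normr_ge0 (repr u x : Rcomplex R)).
Qed.

Lemma ReD (z w : R[i]) : complex.Re (z + w) = complex.Re z + complex.Re w.
Proof. by case: z w => ? ? [? ?]. Qed.
Lemma ImD (z w : R[i]) : complex.Im (z + w) = complex.Im z + complex.Im w.
Proof. by case: z w => ? ? [? ?]. Qed.
Lemma ReN (z : R[i]) : complex.Re (- z) = - complex.Re z.
Proof. by case: z => ? ?. Qed.
Lemma ImN (z : R[i]) : complex.Im (- z) = - complex.Im z.
Proof. by case: z => ? ?. Qed.
Lemma ReM (z w : R[i]) :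
  complex.Re (z * w) = complex.Re z * complex.Re w - complex.Im z * complex.Im w.
Proof. by case: z w => ? ? [? ?]. Qed.
Lemma ImM (z w : R[i]) :
  complex.Im (z * w) = complex.Re z * complex.Im w + complex.Im z * complex.Re w.
Proof. by case: z w => ? ? [? ?]. Qed.
Lemma complex_eq (z w : R[i]) :
  complex.Re z = complex.Re w -> complex.Im z = complex.Im w -> z = w.
Proof. by case: z w => ? ? [? ?] /= -> ->. Qed.
Lemma normc_real (z : R[i]) : complex.Im z = 0 ->
  Normc.normc z = `|complex.Re z|.
Proof. by case: z => a b /= ->; rewrite expr0n addr0 sqrtr_sqr. Qed.

(** Real part of a representative; meaningful up to a null set. *)
Definition rv u (x : R) : R := complex.Re (repr u x).
(** Imaginary part of a representative. *)
Definition iv u (x : R) : R := complex.Im (repr u x).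

Lemma rvD u v : AE x : R, rv (u + v) x = rv u x + rv v x.
Proof. by apply: filterS (Linf_reprD u v) => x H; rewrite /rv H ReD. Qed.
Lemma rv0 : AE x : R, rv 0 x = 0.
Proof. by apply: filterS Linf_repr0 => x H; rewrite /rv H. Qed.
Lemma rv1 : AE x : R, rv 1 x = 1.
Proof. by apply: filterS Linf_repr1 => x H; rewrite /rv H. Qed.
Lemma rv_cst t : AE x : R, rv (Linf_cst t%:C) x = t.
Proof. by apply: filterS (Linf_repr_cst t%:C) => x H; rewrite /rv H. Qed.

Lemma measurable_rv u : measurable_fun `[(0:R), 1] (rv u).
Proof. by have /asboolP[[]] := Linf_valP (repr u). Qed.
Lemma measurable_iv u : measurable_fun `[(0:R), 1] (iv u).
Proof. by have /asboolP[[]] := Linf_valP (repr u). Qed.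

(** The cone of classes that are real and nonnegative almost everywhere. *)
Definition Linf_ge0 u := AE x : R, iv u x = 0 /\ 0 <= rv u x.

(** The positive unit ball of L^oo. *)
Definition pos_ball u := AE x : R, iv u x = 0 /\ 0 <= rv u x <= 1.

Lemma pos_ball_ge0 u : pos_ball u -> Linf_ge0 u.
Proof. by apply: filterS => x [-> /andP[]]. Qed.

Lemma Linf_exists (g h : R -> R) (M : R) :
  measurable_fun `[(0:R), 1] g -> measurable_fun `[(0:R), 1] h ->
  (AE x : R, `|g x| <= M) -> (AE x : R, `|h x| <= M) ->
  exists u, AE x : R, repr u x = g x +i* h x.
Proof.
move=> mg mh Mg Mh.
have H : (fun x => g x +i* h x) \in @Linf_fun R.
  apply/asboolP; split; first by split.
  exists (M + M); apply: filterS2 Mg Mh => x gx hx.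
  have -> : g x +i* h x = (g x)%:C + (0 +i* h x).
    by apply: complex_eq => /=; rewrite ?addr0 ?add0r.
  apply: le_trans (le_normcD (_ : Rcomplex R) _) _.
  by rewrite lerD//= expr0n ?addr0 ?add0r sqrtr_sqr.
by exists (\pi_L%qT (MkLinfFun H)); exact: (repr_pi (MkLinfFun H)).
Qed.

Lemma pos_ball_exists (g : R -> R) : measurable_fun `[(0:R), 1] g ->
  (AE x : R, 0 <= g x <= 1) ->
  exists2 u, pos_ball u & AE x : R, rv u x = g x.
Proof.
move=> mg g01.
have [||u Hu] := @Linf_exists g (fun=> 0) 1 mg (measurable_cst _).
- by apply: filterS g01 => x /andP[x0 x1]; rewrite ger0_norm.
- by apply: aeW => x; rewrite normr0 ler01.
exists u.
  by apply: filterS2 Hu g01 => x ux gx; rewrite /iv /rv ux.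
by apply: filterS Hu => x; rewrite /rv => ->.
Qed.

Lemma rv_eqP u v : Linf_ge0 u -> Linf_ge0 v ->
  (u = v <-> AE x : R, rv u x = rv v x).
Proof.
move=> Hu Hv; split=> [->|H]; first exact: aeW.
apply/Linf_eqP; apply: filterS3 Hu Hv H => x [iu _] [ivx _] E.
by apply: complex_eq => //; move: iu ivx; rewrite /iv => -> ->.
Qed.

Lemma distP u v r : Linf_ge0 u -> Linf_ge0 v ->
  (Linf_norm (u - v) <= r <-> AE x : R, `|rv u x - rv v x| <= r).
Proof.
move=> Hu Hv.
have H : AE x : R, Normc.normc (repr (u - v) x) = `|rv u x - rv v x|.
  apply: filterS3 Hu Hv (Linf_reprB u v) => x [iu _] [ivx _] ->.
  move: iu ivx; rewrite /iv => iu ivx.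
  by rewrite normc_real ?ReD ?ReN// ImD ImN iu ivx subrr.
split=> [/Linf_norm_le|Hr]; first by apply: filterS2 H => x ->.
by apply/Linf_norm_le; apply: filterS2 H Hr => x ->.
Qed.

Lemma Linf0_ge0 : Linf_ge0 0.
Proof. by apply: filterS Linf_repr0 => x; rewrite /iv/rv => ->. Qed.

Lemma pos_ball_cst t : 0 <= t <= 1 -> pos_ball (Linf_cst t%:C).
Proof. by move=> t01; apply: filterS (Linf_repr_cst t%:C) => x; rewrite /iv/rv => ->. Qed.
Lemma pos_ball0 : pos_ball 0.
Proof. by rewrite -(rmorph0 (@Linf_cst R)); apply: pos_ball_cst; rewrite lexx ler01. Qed.
Lemma pos_ball1 : pos_ball 1.
Proof. by rewrite -(rmorph1 (@Linf_cst R)); apply: pos_ball_cst; rewrite lexx ler01. Qed.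

Lemma ge0_norm_leP u r : Linf_ge0 u -> (Linf_norm u <= r <-> AE x : R, rv u x <= r).
Proof.
move=> Hu; have := distP u 0 r Hu Linf0_ge0; rewrite subr0 => ->.
by split=> H; apply: filterS3 Hu rv0 H => x [_ u0] ->; rewrite subr0 ger0_norm.
Qed.

Lemma pos_ballP u : Linf_ge0 u -> Linf_norm u <= 1 -> pos_ball u.
Proof.
move=> Hu /(ge0_norm_leP _ _ Hu) H; apply: filterS2 Hu H => x [-> ->] ->//.
Qed.

Lemma pos_ball_norm u : pos_ball u -> Linf_norm u <= 1.
Proof.
move=> Hu; apply/(ge0_norm_leP _ _ (pos_ball_ge0 _ Hu)).
by apply: filterS Hu => x [_ /andP[]].
Qed.

Lemma ge0M u v : Linf_ge0 u -> Linf_ge0 v -> Linf_ge0 (u * v).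
Proof.
move=> Hu Hv; apply: filterS3 Hu Hv (Linf_reprM u v) => x.
rewrite /iv /rv => -[iu u0] [ivx v0] ->; rewrite ImM ReM iu ivx !mulr0 mul0r.
by rewrite addr0 subr0 mulr_ge0.
Qed.

Lemma rvM u v : Linf_ge0 u -> Linf_ge0 v -> AE x : R, rv (u * v) x = rv u x * rv v x.
Proof.
move=> Hu Hv; apply: filterS3 Hu Hv (Linf_reprM u v) => x.
by rewrite /iv /rv => -[iu u0] [ivx v0] ->; rewrite ReM iu mul0r subr0.
Qed.

Lemma pos_ballM u v : pos_ball u -> pos_ball v -> pos_ball (u * v).
Proof.
move=> Hu Hv; have H := ge0M _ _ (pos_ball_ge0 _ Hu) (pos_ball_ge0 _ Hv).
have E := rvM _ _ (pos_ball_ge0 _ Hu) (pos_ball_ge0 _ Hv).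
apply: filterS4 Hu Hv H E => x [_ /andP[a b]] [_ /andP[c d]] [-> _] ->.
split => //.
by rewrite mulr_ge0//= mulr_ile1.
Qed.
End LinfAlmostEverywhere.

(** * The order of the positive unit ball is determined by its metric *)

(** Replaces maxima and minima by their values, one goal for each case. *)
Ltac minmax := rewrite ?maxEle ?minEle;
  repeat (case: ifPn; [move=> ?|rewrite -ltNge => ?]).

Section BallIsometry.
Context {R : realType}.
Local Notation L := (Linf R).
Implicit Types u v w e x y z : L.

(** The order of L^oo, used between elements of the positive unit ball. *)
Definition ae_le u v := AE x : R, rv u x <= rv v x.

Lemma ae_le_anti u v : pos_ball u -> pos_ball v -> ae_le u v -> ae_le v u -> u = v.
Proof.
move=> Hu Hv uv vu; apply/(rv_eqP _ _ (pos_ball_ge0 _ Hu) (pos_ball_ge0 _ Hv)).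
by apply: filterS2 uv vu => x ? ?; apply/eqP; rewrite eq_le; apply/andP.
Qed.

Lemma pos_ball_distP u v r : pos_ball u -> pos_ball v ->
  Linf_norm (u - v) <= r <-> AE x : R, `|rv u x - rv v x| <= r.
Proof. by move=> /pos_ball_ge0 Hu /pos_ball_ge0 Hv; exact: distP. Qed.

Lemma pos_ball_dist0P u r : pos_ball u ->
  Linf_norm (u - 0) <= r <-> AE x : R, rv u x <= r.
Proof. by move=> /pos_ball_ge0 Hu; rewrite subr0; exact: ge0_norm_leP. Qed.

Lemma pos_ball_dist1P u r : pos_ball u ->
  Linf_norm (u - 1) <= r <-> AE x : R, 1 - rv u x <= r.
Proof.
move=> Hu; rewrite (pos_ball_distP _ _ _ Hu pos_ball1); split=> H;
  apply: filterS3 Hu rv1 H => x [_ /andP[a b]] ->.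
  by rewrite distrC ger0_norm // subr_ge0.
by rewrite distrC ger0_norm // subr_ge0.
Qed.

Let half01 : 0 <= (2^-1 : R) <= 1. Proof. lra. Qed.

(** The constant 1 in metric terms: the centre 1/2 is the only point at distance at
    most 1/2 from both 0 and 1, whereas for x <> 1 both 1/2 and x/2 are at distance
    at most 1/2 from 0 and x. *)
Lemma one_dist_char x : pos_ball x -> (x = 1 <-> forall y z, pos_ball y -> pos_ball z ->
  Linf_norm (y - 0) <= 2^-1 -> Linf_norm (y - x) <= 2^-1 ->
  Linf_norm (z - 0) <= 2^-1 -> Linf_norm (z - x) <= 2^-1 -> y = z).
Proof.
move=> Hx; split=> [-> y z Hy Hz | H].
  move=> /(pos_ball_dist0P _ _ Hy) y0 /(pos_ball_dist1P _ _ Hy) y1.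
  move=> /(pos_ball_dist0P _ _ Hz) z0 /(pos_ball_dist1P _ _ Hz) z1.
  apply/(rv_eqP _ _ (pos_ball_ge0 _ Hy) (pos_ball_ge0 _ Hz)).
  by apply: filterS4 y0 y1 z0 z1 => t ? ? ? ?; lra.
pose c := Linf_cst (2^-1 : R)%:C.
have Hc : pos_ball c by exact: pos_ball_cst.
have Hcx : pos_ball (c * x) by exact: pos_ballM.
have E := rvM _ _ (pos_ball_ge0 _ Hc) (pos_ball_ge0 _ Hx).
have {}H : c = c * x.
  apply: H => //.
  - by apply/(pos_ball_dist0P _ _ Hc); apply: filterS (rv_cst 2^-1) => t ->.
  - apply/(pos_ball_distP _ _ _ Hc Hx); apply: filterS2 Hx (rv_cst 2^-1).
    by move=> t [_ /andP[? ?]] ->; rewrite ler_norml; apply/andP; split; lra.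
  - apply/(pos_ball_dist0P _ _ Hcx); apply: filterS3 Hx E (rv_cst 2^-1).
    by move=> t [_ /andP[? ?]] -> ->; lra.
  - apply/(pos_ball_distP _ _ _ Hcx Hx); apply: filterS3 Hx E (rv_cst 2^-1).
    by move=> t [_ /andP[? ?]] -> ->; rewrite ler_norml; apply/andP; split; lra.
apply/(rv_eqP _ _ (pos_ball_ge0 _ Hx) (pos_ball_ge0 _ pos_ball1)).
apply: filterS4 E (rv_cst 2^-1) rv1 Hx => t.
by rewrite -H -/c => E1 E2 -> _; move: E1; rewrite E2 => ?; lra.
Qed.

(** The order in terms of the metric and of the points 0 and 1: the first condition
    says u <= max(v, 1/2), the second min(u, 1/2) <= v. *)
Lemma ae_le_dist_char u v : pos_ball u -> pos_ball v -> (ae_le u v <->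
  (forall x, pos_ball x -> Linf_norm (x - 0) <= 2^-1 -> Linf_norm (x - v) <= 2^-1 ->
     Linf_norm (x - u) <= 2^-1) /\
  (forall x, pos_ball x -> Linf_norm (x - 1) <= 2^-1 -> Linf_norm (x - u) <= 2^-1 ->
     Linf_norm (x - v) <= 2^-1)).
Proof.
move=> Hu Hv; split=> [uv|[H1 H2]].
  split=> x Hx.
    move=> /(pos_ball_dist0P _ _ Hx) x0 /(pos_ball_distP _ _ _ Hx Hv) xv.
    apply/(pos_ball_distP _ _ _ Hx Hu); apply: filterS5 Hx Hu uv x0 xv => t.
    move=> [_ /andP[? ?]] [_ /andP[? ?]] ? ?.
    by rewrite !ler_norml => /andP[? ?]; apply/andP; split; lra.
  move=> /(pos_ball_dist1P _ _ Hx) x0 /(pos_ball_distP _ _ _ Hx Hu) xv.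
  apply/(pos_ball_distP _ _ _ Hx Hv); apply: filterS5 Hx Hv uv x0 xv => t.
  move=> [_ /andP[? ?]] [_ /andP[? ?]] ? ?.
  by rewrite !ler_norml => /andP[? ?]; apply/andP; split; lra.
(* The extreme centres of balls of radius 1/2 containing 0 and v, respectively
   1 and u. *)
have [||x Hx Ex] := @pos_ball_exists R (fun t => Num.max (rv v t - 2^-1) 0).
- apply: measurable_realfun.measurable_maxr; last exact: measurable_cst.
  by apply: measurable_realfun.measurable_funB; [exact: measurable_rv|exact: measurable_cst].
- by apply: filterS Hv => t [_ /andP[? ?]]; minmax; apply/andP; split; lra.
have [||y Hy Ey] := @pos_ball_exists R (fun t => Num.min (rv u t + 2^-1) 1).
- apply: measurable_realfun.measurable_minr; last exact: measurable_cst.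
  by apply: measurable_realfun.measurable_funD; [exact: measurable_rv|exact: measurable_cst].
- by apply: filterS Hu => t [_ /andP[? ?]]; minmax; apply/andP; split; lra.
have {}H1 : Linf_norm (x - u) <= 2^-1.
  apply: H1 => //.
    apply/(pos_ball_dist0P _ _ Hx); apply: filterS2 Ex Hv => t -> [_ /andP[? ?]].
    by minmax; lra.
  apply/(pos_ball_distP _ _ _ Hx Hv); apply: filterS2 Ex Hv => t -> [_ /andP[? ?]].
  by rewrite ler_norml; minmax; apply/andP; split; lra.
have {}H2 : Linf_norm (y - v) <= 2^-1.
  apply: H2 => //.
    apply/(pos_ball_dist1P _ _ Hy); apply: filterS2 Ey Hu => t -> [_ /andP[? ?]].
    by minmax; lra.
  apply/(pos_ball_distP _ _ _ Hy Hu); apply: filterS2 Ey Hu => t -> [_ /andP[? ?]].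
  by rewrite ler_norml; minmax; apply/andP; split; lra.
move/(pos_ball_distP _ _ _ Hx Hu) : H1 => H1; move/(pos_ball_distP _ _ _ Hy Hv) : H2 => H2.
have H : AE t : R, `|rv x t - rv u t| <= 2^-1 /\ `|rv y t - rv v t| <= 2^-1.
  by apply: filterS2 H1 H2.
apply: filterS5 H Ex Ey Hu Hv => t + xt yt [_ /andP[? ?]] [_ /andP[? ?]].
by rewrite xt yt !ler_norml; minmax => -[/andP[? ?] /andP[? ?]]; lra.
Qed.

Lemma cst_dist_char u t : 0 <= t <= 1 -> pos_ball u -> (u = Linf_cst t%:C <->
  Linf_norm (u - 0) <= t /\ Linf_norm (u - 1) <= 1 - t).
Proof.
move=> t01 Hu; have Hc : pos_ball (Linf_cst t%:C) by exact: pos_ball_cst.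
split=> [->|[/(pos_ball_dist0P _ _ Hu) H0 /(pos_ball_dist1P _ _ Hu) H1]].
  by split; [apply/(pos_ball_dist0P _ _ Hc)|apply/(pos_ball_dist1P _ _ Hc)];
    apply: filterS (rv_cst t) => x ->; lra.
apply/(rv_eqP _ _ (pos_ball_ge0 _ Hu) (pos_ball_ge0 _ Hc)).
by apply: filterS3 H0 H1 (rv_cst t) => x ? ? ->; lra.
Qed.

(** Idempotents: classes of indicator functions of measurable sets. *)
Definition idem e := AE x : R, iv e x = 0 /\ (rv e x = 0 \/ rv e x = 1).

Lemma idem_pos_ball e : idem e -> pos_ball e.
Proof. by apply: filterS => x [-> [|] ->]; split=> //; lra. Qed.

(** Idempotents are the complemented elements of the lattice. *)
Lemma idem_order_char e : pos_ball e -> (idem e <-> exists2 f, pos_ball f &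
  (forall w, pos_ball w -> ae_le w e -> ae_le w f -> w = 0) /\
  (forall w, pos_ball w -> ae_le e w -> ae_le f w -> w = 1)).
Proof.
move=> He; split=> [ie|[f Hf [H0 H1]]].
  have [||f Hf Ef] := @pos_ball_exists R (fun t => 1 - rv e t).
  - by apply: measurable_realfun.measurable_funB; [exact: measurable_cst|exact: measurable_rv].
  - by apply: filterS He => t [_ /andP[? ?]]; apply/andP; split; lra.
  exists f => //; split=> w Hw.
    move=> we wf; apply/(rv_eqP _ _ (pos_ball_ge0 _ Hw) (pos_ball_ge0 _ pos_ball0)).
    have H : AE t : R, rv w t <= rv e t /\ rv w t <= rv f t by apply: filterS2 we wf.
    apply: filterS5 H Ef ie rv0 Hw => t [? ?] ? [_ ee] -> [_ /andP[? ?]].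
    by case: ee => ?; lra.
  move=> we wf; apply/(rv_eqP _ _ (pos_ball_ge0 _ Hw) (pos_ball_ge0 _ pos_ball1)).
  have H : AE t : R, rv e t <= rv w t /\ rv f t <= rv w t by apply: filterS2 we wf.
  apply: filterS5 H Ef ie rv1 Hw => t [? ?] ? [_ ee] -> [_ /andP[? ?]].
  by case: ee => ?; lra.
have [||m Hm Em] := @pos_ball_exists R (fun t => Num.min (rv e t) (rv f t)).
- by apply: measurable_realfun.measurable_minr; exact: measurable_rv.
- by apply: filterS2 He Hf => t [_ /andP[? ?]] [_ /andP[? ?]]; minmax; apply/andP; split; lra.
have [||M HM EM] := @pos_ball_exists R (fun t => Num.max (rv e t) (rv f t)).
- by apply: measurable_realfun.measurable_maxr; exact: measurable_rv.
- by apply: filterS2 He Hf => t [_ /andP[? ?]] [_ /andP[? ?]]; minmax; apply/andP; split; lra.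
have E0 : m = 0.
  by apply: H0 => //; apply: filterS Em => t ->; minmax; lra.
have E1 : M = 1.
  by apply: H1 => //; apply: filterS EM => t ->; minmax; lra.
subst m M.
have H : AE t : R, rv 0 t = Num.min (rv e t) (rv f t) /\ rv 1 t = Num.max (rv e t) (rv f t).
  by apply: filterS2 Em EM.
apply: filterS5 H He Hf rv0 rv1 => t + [-> /andP[? ?]] [_ /andP[? ?]] z0 z1.
by rewrite z0 z1; minmax => -[? ?]; split=> //; [left|right]; lra.
Qed.
End BallIsometry.

(** * Isometries of the positive unit ball *)

Section Idempotents.
Context {R : realType}.
Local Notation L := (Linf R).
Implicit Types u v w e y z : L.

Lemma idem_exists (b : R -> bool) : measurable_fun `[(0:R), 1] b ->
  exists2 e, idem e & AE x : R, rv e x = if b x then 1 else 0.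
Proof.
move=> mb.
have [||e He Ee] := @pos_ball_exists R (fun x => if b x then 1 else 0).
- by apply: measurable_fun_if => //; exact: measurable_cst.
- by apply: aeW => x; case: (b x); lra.
exists e => //; apply: filterS2 He Ee => x [-> _] ->.
by split=> //; case: (b x); [right|left].
Qed.

Lemma pos_ball_cstM t u : 0 <= t <= 1 -> pos_ball u -> pos_ball (Linf_cst t%:C * u).
Proof. by move=> t01 Hu; apply: pos_ballM => //; exact: pos_ball_cst. Qed.

Lemma rv_cstM t u : 0 <= t <= 1 -> pos_ball u -> AE x : R, rv (Linf_cst t%:C * u) x = t * rv u x.
Proof.
move=> t01 Hu; have := rvM _ _ (pos_ball_ge0 _ (pos_ball_cst _ t01)) (pos_ball_ge0 _ Hu).
by apply: filterS2 (rv_cst t) => x ->.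
Qed.

(** For an idempotent e, t e is the greatest lower bound of the constant t and e. *)
Lemma cst_idem_glb t e z : 0 <= t <= 1 -> idem e -> pos_ball z ->
  (z = Linf_cst t%:C * e <-> [/\ ae_le z (Linf_cst t%:C), ae_le z e &
    forall w, pos_ball w -> ae_le w (Linf_cst t%:C) -> ae_le w e -> ae_le w z]).
Proof.
move=> t01 ie Hz; have He := idem_pos_ball _ ie.
have Hte := pos_ball_cstM _ _ t01 He; have E := rv_cstM _ _ t01 He.
have A : [/\ ae_le (Linf_cst t%:C * e) (Linf_cst t%:C), ae_le (Linf_cst t%:C * e) e &
    forall w, pos_ball w -> ae_le w (Linf_cst t%:C) -> ae_le w e -> ae_le w (Linf_cst t%:C * e)].
  split.
  - by apply: filterS3 ie E (rv_cst t) => x [_ [] e1] -> ->; rewrite e1; lra.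
  - by apply: filterS3 ie E (rv_cst t) => x [_ [] e1] -> _; rewrite e1; lra.
  - move=> w Hw w1 w2; apply: filterS5 w1 w2 ie E (rv_cst t).
    by move=> x w1 w2 [_ [] e1] -> c1; move: w1 w2; rewrite e1 c1 => ? ?; lra.
split=> [->//|[z1 z2 z3]].
case: A => A1 A2 A3.
by apply: ae_le_anti => //; [exact: A3|exact: z3].
Qed.

(** The operation op acts on the positive unit ball pointwise through phi, which
    maps the unit square to [0,1], is monotone, and 1-Lipschitz for the l^1 norm. *)
Definition pointwise_op (phi : R -> R -> R) (op : L -> L -> L) :=
  [/\ forall a b, 0 <= a <= 1 -> 0 <= b <= 1 -> 0 <= phi a b <= 1,
      forall a b t s, 0 <= t <= a -> 0 <= s <= b -> a <= 1 -> b <= 1 ->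
        phi t s <= phi a b <= phi t s + (a - t) + (b - s),
      forall u v, pos_ball u -> pos_ball v -> pos_ball (op u v) &
      forall u v, pos_ball u -> pos_ball v -> AE x : R, rv (op u v) x = phi (rv u x) (rv v x)].

Lemma op_ub phi op : pointwise_op phi op -> forall u v e t s, pos_ball u -> pos_ball v ->
  idem e -> 0 <= t <= 1 -> 0 <= s <= 1 ->
  ae_le (Linf_cst t%:C * e) u -> ae_le (Linf_cst s%:C * e) v ->
  ae_le (Linf_cst (phi t s)%:C * e) (op u v).
Proof.
move=> [p01 pm pB pE] u v e t s Hu Hv ie t01 s01 tu sv.
have He := idem_pos_ball _ ie.
have H : AE x : R, t * rv e x <= rv u x /\ s * rv e x <= rv v x.
  apply: filterS4 (rv_cstM _ _ t01 He) (rv_cstM _ _ s01 He) tu sv.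
  by move=> x ? ? ? ?; split; lra.
have H' : AE x : R, 0 <= rv u x <= 1 /\ 0 <= rv v x <= 1.
  by apply: filterS2 Hu Hv => x [? ?] [? ?].
apply: filterS5 H H' ie (pE _ _ Hu Hv) (rv_cstM _ _ (p01 _ _ t01 s01) He).
move=> x [tu' sv'] [u01 v01] [_ ee] -> ->.
case: ee tu' sv' => ->; rewrite ?mulr0 ?mulr1 => tu' sv'.
  by case/andP: (p01 _ _ u01 v01).
by case/andP: (pm (rv u x) (rv v x) t s ltac:(lra) ltac:(lra) ltac:(lra) ltac:(lra)).
Qed.

(** Together with the previous lemma: op u v is the least upper bound of the
    elements phi(t, s) e with e idempotent, t e <= u and s e <= v. *)
Lemma op_lub phi op : pointwise_op phi op -> forall u v w, pos_ball u -> pos_ball v -> pos_ball w ->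
  (forall e t s, idem e -> 0 <= t <= 1 -> 0 <= s <= 1 ->
    ae_le (Linf_cst t%:C * e) u -> ae_le (Linf_cst s%:C * e) v ->
    ae_le (Linf_cst (phi t s)%:C * e) w) ->
  ae_le (op u v) w.
Proof.
move=> [p01 pm pB pE] u v w Hu Hv Hw H.
have K t s : 0 <= t <= 1 -> 0 <= s <= 1 ->
    AE x : R, t <= rv u x -> s <= rv v x -> phi t s <= rv w x.
  move=> t01 s01.
  have [|e ie Ee] := idem_exists (fun x => (t <= rv u x) && (s <= rv v x)).
    by apply: measurable_and; apply: measurable_realfun.measurable_fun_ler;
      try exact: measurable_cst; exact: measurable_rv.
  have He := idem_pos_ball _ ie.
  have {}H : ae_le (Linf_cst (phi t s)%:C * e) w.
    apply: H => //.
      apply: filterS3 Hu Ee (rv_cstM _ _ t01 He) => x [_ /andP[? ?]] + ->.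
      by case: ifPn => [/andP[? ?]|_] ->; lra.
    apply: filterS3 Hv Ee (rv_cstM _ _ s01 He) => x [_ /andP[? ?]] + ->.
    by case: ifPn => [/andP[? ?]|_] ->; lra.
  apply: filterS3 H Ee (rv_cstM _ _ (p01 _ _ t01 s01) He).
  by move=> x Hx Ex Rx tu sv; move: Hx; rewrite Rx Ex tu sv mulr1.
(* Countably many grid points (k/(n+1), l/(n+1)) suffice. *)
pose q (k n : nat) : R := k%:R / n.+1%:R.
have K' : AE x : R, forall n k l, 0 <= q k n <= 1 -> 0 <= q l n <= 1 ->
    q k n <= rv u x -> q l n <= rv v x -> phi (q k n) (q l n) <= rv w x.
  apply: ae_foralln => n; apply: ae_foralln => k; apply: ae_foralln => l.
  have [k01|k01] := boolP (0 <= q k n <= 1); last exact: aeW.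
  have [l01|l01] := boolP (0 <= q l n <= 1); last exact: aeW.
  by apply: filterS (K _ _ k01 l01) => x Kx _ _.
apply: filterS4 Hu Hv K' (pE _ _ Hu Hv) => x [_ /andP[u0 u1]] [_ /andP[v0 v1]] {}K ->.
rewrite leNgt; apply/negP => wx.
have /ltr_add_invr[n Hn] : rv w x / 2 < phi (rv u x) (rv v x) / 2 by lra.
have q_ge0 k : 0 <= q k n by rewrite /q divr_ge0.
have approx a : 0 <= a -> exists k, q k n <= a <= q k n + n.+1%:R^-1.
  move=> a0; have an0 : 0 <= a * n.+1%:R by rewrite mulr_ge0.
  exists (Num.truncn (a * n.+1%:R)); rewrite /q.
  have /andP[k1 k2] := Num.Theory.truncn_itv an0.
  have n0 : 0 < n.+1%:R :> R by rewrite ltr0n.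
  rewrite ler_pdivrMr// k1 /= -[X in _ <= _ + X]mul1r -mulrDl ler_pdivlMr//.
  by rewrite natr1 ltW.
have [k /andP[k1 k2]] := approx _ u0; have [l /andP[l1 l2]] := approx _ v0.
have /andP[_ A1] := pm (rv u x) (rv v x) (q k n) (q l n)
  ltac:(rewrite q_ge0 k1//) ltac:(rewrite q_ge0 l1//) u1 v1.
have := K n k l ltac:(rewrite q_ge0 (le_trans k1)//) ltac:(rewrite q_ge0 (le_trans l1)//) k1 l1.
move: (phi (q k n) (q l n)) (phi _ _) A1 Hn => P P'.
move: (n.+1%:R^-1) k2 l2 => d k2 l2 A1 Hn Pw; clear - k2 l2 A1 Hn Pw.
by lra.
Qed.
End Idempotents.

(** Surjective isometries of the positive unit ball that fix 0; the values outside
    the ball are irrelevant. *)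
Definition ball_isometry {R : realType} (Phi : Linf R -> Linf R) :=
  [/\ forall u, pos_ball u -> pos_ball (Phi u),
      forall v, pos_ball v -> exists2 u, pos_ball u & Phi u = v,
      forall u v, pos_ball u -> pos_ball v -> Linf_norm (Phi u - Phi v) = Linf_norm (u - v) &
      Phi 0 = 0].

Section BallIsometryTheory.
Context {R : realType} (Phi : Linf R -> Linf R).
Hypothesis HPhi : ball_isometry Phi.
Local Notation L := (Linf R).
Implicit Types u v w e y z : L.

Let PB u : pos_ball u -> pos_ball (Phi u). Proof. by case: HPhi => H *; exact: H. Qed.
Let Psurj v : pos_ball v -> exists2 u, pos_ball u & Phi u = v.
Proof. by case: HPhi => _ H *; exact: H. Qed.
Let Pd u v : pos_ball u -> pos_ball v -> Linf_norm (Phi u - Phi v) = Linf_norm (u - v).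
Proof. by case: HPhi => _ _ H *; exact: H. Qed.
Let P0 : Phi 0 = 0. Proof. by case: HPhi. Qed.
Let B0 := @pos_ball0 R. Let B1 := @pos_ball1 R.

Lemma ball_isometry_inj u v : pos_ball u -> pos_ball v -> Phi u = Phi v -> u = v.
Proof.
move=> Hu Hv E; apply/eqP; rewrite -subr_eq0; apply/eqP.
by apply: Linf_norm0_eq; rewrite -Pd// E subrr Linf_norm0.
Qed.

Lemma ball_isometry1 : Phi 1 = 1.
Proof.
apply/(one_dist_char _ (PB _ B1)) => _ _ /Psurj[y Hy <-] /Psurj[z Hz <-].
rewrite -P0 !Pd// => y0 y1 z0 z1; congr Phi.
by apply: (one_dist_char _ B1).1.
Qed.

Lemma ball_isometry_le u v : pos_ball u -> pos_ball v -> ae_le (Phi u) (Phi v) <-> ae_le u v.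
Proof.
move=> Hu Hv; rewrite (ae_le_dist_char _ _ Hu Hv).
rewrite (ae_le_dist_char _ _ (PB _ Hu) (PB _ Hv)).
split=> -[H1 H2]; split.
- by move=> x Hx x0 xv; rewrite -Pd//; apply: H1;
    [exact: PB|rewrite -[X in _ - X]P0 Pd//|rewrite Pd].
- by move=> x Hx x0 xv; rewrite -Pd//; apply: H2;
    [exact: PB|rewrite -[X in _ - X]ball_isometry1 Pd//|rewrite Pd].
- by move=> _ /Psurj[x Hx <-]; rewrite -P0 !Pd//; exact: H1.
- by move=> _ /Psurj[x Hx <-]; rewrite -ball_isometry1 !Pd//; exact: H2.
Qed.

Lemma ball_isometry_cst t : 0 <= t <= 1 -> Phi (Linf_cst t%:C) = Linf_cst t%:C.
Proof.
move=> t01; have Ht := pos_ball_cst _ t01.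
apply/(cst_dist_char _ _ t01 (PB _ Ht)).
rewrite -{1}P0 -{1}ball_isometry1 !Pd//.
exact/(cst_dist_char _ _ t01 Ht).
Qed.

Lemma ball_isometry_idem e : pos_ball e -> idem (Phi e) <-> idem e.
Proof.
move=> He; rewrite (idem_order_char _ He) (idem_order_char _ (PB _ He)).
split=> [[_ /Psurj[f Hf <-] [H0 H1]]|[f Hf [H0 H1]]].
  exists f => //; split=> w Hw ew fw; apply: ball_isometry_inj => //.
    by rewrite P0; apply: H0; [exact: PB|apply/ball_isometry_le..].
  by rewrite ball_isometry1; apply: H1; [exact: PB|apply/ball_isometry_le..].
exists (Phi f); first exact: PB.
split=> _ /Psurj[w Hw <-] /ball_isometry_le ew /ball_isometry_le fw.
  by rewrite -P0; congr Phi; apply: H0 => //; [exact: ew|exact: fw].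
by rewrite -ball_isometry1; congr Phi; apply: H1 => //; [exact: ew|exact: fw].
Qed.

Lemma ball_isometry_cst_idem t e : 0 <= t <= 1 -> idem e ->
  Phi (Linf_cst t%:C * e) = Linf_cst t%:C * Phi e.
Proof.
move=> t01 ie; have He := idem_pos_ball _ ie; have Ht := pos_ball_cst _ t01.
have Hte := pos_ball_cstM _ _ t01 He.
apply/(cst_idem_glb _ _ _ t01 ((ball_isometry_idem _ He).2 ie) (PB _ Hte)).
have [H1 H2 H3] := (cst_idem_glb _ _ _ t01 ie Hte).1 erefl.
have Ec := ball_isometry_cst _ t01; split.
- by rewrite -[X in ae_le _ X]Ec; exact/ball_isometry_le.
- exact/ball_isometry_le.
- move=> _ /Psurj[w Hw <-]; rewrite -[X in ae_le _ X -> _]Ec => /(ball_isometry_le _ _ Hw Ht) w1.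
  move=> /(ball_isometry_le _ _ Hw He) w2.
  by apply/ball_isometry_le => //; exact: H3.
Qed.

Lemma ball_isometry_op phi op : pointwise_op phi op ->
  forall u v, pos_ball u -> pos_ball v -> Phi (op u v) = op (Phi u) (Phi v).
Proof.
move=> Hop u v Hu Hv; have [p01 _ opB _] := Hop.
have Huv := opB _ _ Hu Hv; have HP := opB _ _ (PB _ Hu) (PB _ Hv).
apply: ae_le_anti => //; first exact: PB; last first.
  apply: (op_lub _ _ Hop); [exact: PB..|] => e' t s ie' t01 s01.
  have [e He ee'] := Psurj _ (idem_pos_ball _ ie').
  have ie : idem e by apply/ball_isometry_idem => //; rewrite ee'.
  rewrite -ee' -!ball_isometry_cst_idem//; last exact: p01.
  have Hte := pos_ball_cstM _ _ t01 He; have Hse := pos_ball_cstM _ _ s01 He.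
  have Hpe := pos_ball_cstM _ _ (p01 _ _ t01 s01) He.
  move=> /(ball_isometry_le _ _ Hte Hu) tu /(ball_isometry_le _ _ Hse Hv) sv.
  by apply/ball_isometry_le => //; exact: (op_ub _ _ Hop).
have [w Hw ww] := Psurj _ HP.
rewrite -ww; apply/ball_isometry_le => //.
apply: (op_lub _ _ Hop) => // e t s ie t01 s01 tu sv.
have He := idem_pos_ball _ ie.
have Hte := pos_ball_cstM _ _ t01 He; have Hse := pos_ball_cstM _ _ s01 He.
have Hpe := pos_ball_cstM _ _ (p01 _ _ t01 s01) He.
apply/ball_isometry_le => //; rewrite ww ball_isometry_cst_idem//; last exact: p01.
have ie' := (ball_isometry_idem _ He).2 ie.
by apply: (op_ub _ _ Hop) => //; try exact: PB;
  rewrite -ball_isometry_cst_idem//; apply/ball_isometry_le.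
Qed.

Lemma ball_isometryM u v : pos_ball u -> pos_ball v -> Phi (u * v) = Phi u * Phi v.
Proof.
apply: (ball_isometry_op (fun a b => a * b) (fun u v => u * v)); split.
- by move=> a b /andP[? ?] /andP[? ?]; rewrite mulr_ge0//= mulr_ile1.
- by move=> a b t s /andP[? ?] /andP[? ?] ? ?; apply/andP; split; nra.
- by move=> ? ?; exact: pos_ballM.
- by move=> ? ? /pos_ball_ge0 ? /pos_ball_ge0 ?; exact: rvM.
Qed.

(** Additivity where the sum stays in the ball, deduced from the preservation of
    midpoints. *)
Lemma ball_isometryD u v : pos_ball u -> pos_ball v -> pos_ball (u + v) -> Phi (u + v) = Phi u + Phi v.
Proof.
pose h : L := Linf_cst (2^-1 : R)%:C.
have h01 : 0 <= (2^-1:R) <= 1 by lra.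
have hD w : w = h * w + h * w.
  rewrite -mulrDl /h -rmorphD /= -[X in Linf_cst X]rmorphD/=.
  have -> : (2^-1 + 2^-1 : R) = 1 by lra.
  by rewrite !rmorph1 mul1r.
have H u' v' : pos_ball u' -> pos_ball v' -> Phi (h * u' + h * v') = h * Phi u' + h * Phi v'.
  apply: (ball_isometry_op (fun a b => 2^-1 * a + 2^-1 * b) (fun u v => h * u + h * v)).
  have E x y : pos_ball x -> pos_ball y -> AE t : R, rv (h * x + h * y) t = 2^-1 * rv x t + 2^-1 * rv y t.
    move=> Hx Hy; apply: filterS3 (rvD (h * x) (h * y)) (rv_cstM _ _ h01 Hx) (rv_cstM _ _ h01 Hy).
    by move=> t -> -> ->.
  split => //.
  - by move=> a b /andP[? ?] /andP[? ?]; lra.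
  - by move=> a b t s /andP[? ?] /andP[? ?] ? ?; lra.
  - move=> x y Hx Hy.
    apply: filterS5 Hx Hy (E _ _ Hx Hy) (filterI (pos_ball_cstM _ _ h01 Hx) (pos_ball_cstM _ _ h01 Hy))
      (Linf_reprD (h * x) (h * y)).
    move=> t [_ ?] [_ ?] -> [[i1 _] [i2 _]]; rewrite /iv => ->; split; last by lra.
    by move: i1 i2; rewrite ImD /iv => -> ->; rewrite addr0.
move=> Hu Hv Huv.
have HS w : pos_ball w -> Phi (h * w) = h * Phi w.
  by move=> Hw; rewrite ball_isometryM ?ball_isometry_cst//; exact: pos_ball_cst.
have E : h * Phi (u + v) = h * Phi u + h * Phi v by rewrite -HS// mulrDr H.
by rewrite [LHS]hD E addrACA -!hD.
Qed.

Lemma ball_isometryZ t u : 0 <= t <= 1 -> pos_ball u -> Phi (Linf_cst t%:C * u) = Linf_cst t%:C * Phi u.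
Proof.
by move=> t01 Hu; rewrite ball_isometryM ?ball_isometry_cst//; exact: pos_ball_cst.
Qed.

End BallIsometryTheory.

(** * Decomposition of classes into elements of the positive unit ball *)

Section Extension.
Context {R : realType}.
Local Notation L := (Linf R).
Implicit Types u v w a b c d : L.

(** The class of a real constant. *)
Definition rcst (t : R) : L := Linf_cst t%:C.
(** The class of the constant i. *)
Definition icst : L := Linf_cst 'i%C.

Lemma rcstM s t : rcst (s * t) = rcst s * rcst t.
Proof. by rewrite /rcst !rmorphM. Qed.
Lemma rcst0 : rcst 0 = 0. Proof. by rewrite /rcst !rmorph0. Qed.
Lemma rcst1 : rcst 1 = 1. Proof. by rewrite /rcst !rmorph1. Qed.
Lemma icst2 : icst * icst = -1.
Proof.
rewrite /icst -rmorphM /= -expr2 -(rmorph1 (@Linf_cst R)) -rmorphN.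
by congr Linf_cst; apply: complex_eq => /=; lra.
Qed.

(** Positive and negative parts of the real and imaginary parts, rescaled. *)
Lemma Linf_decompose u : exists N a b c d,
  [/\ 0 < N, pos_ball a /\ pos_ball b, pos_ball c /\ pos_ball d &
      u = rcst N * (a - b) + icst * (rcst N * (c - d))].
Proof.
pose N := Linf_norm u + 1; have N0 : 0 < N.
  by rewrite /N ltr_wpDl// Linf_norm_ge0.
have uN : AE x : R, `|rv u x| <= N /\ `|iv u x| <= N.
  apply: filterS ((Linf_norm_le u _).1 (lexx _)) => x.
  rewrite /rv /iv; case: (repr u x) => p q /= H.
  have H' : Num.sqrt (p ^+ 2 + q ^+ 2) <= N by rewrite (le_trans H)// /N lerDl ler01.
  have S0 : 0 <= p ^+ 2 + q ^+ 2 by rewrite addr_ge0 ?sqr_ge0.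
  by split; apply: le_trans H'; rewrite -sqrtr_sqr ler_sqrt// ?lerDl ?lerDr ?sqr_ge0.
have part (f : R -> R) : measurable_fun `[(0:R), 1] f -> (AE x : R, `|f x| <= N) ->
    exists a b, [/\ pos_ball a, pos_ball b & AE x : R, f x = N * (rv a x - rv b x)].
  move=> mf fN.
  have [||a Ha Ea] := @pos_ball_exists R (fun x => Num.max (f x) 0 / N).
  - apply: measurable_realfun.measurable_funM; last exact: measurable_cst.
    by apply: measurable_realfun.measurable_maxr => //; exact: measurable_cst.
  - apply: filterS fN => x; rewrite ler_norml => /andP[? ?].
    rewrite ler_pdivrMr// mul1r; apply/andP; split; last by minmax; lra.
    by apply: divr_ge0; [minmax; lra|exact: ltW].
  have [||b Hb Eb] := @pos_ball_exists R (fun x => Num.max (- f x) 0 / N).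
  - apply: measurable_realfun.measurable_funM; last exact: measurable_cst.
    apply: measurable_realfun.measurable_maxr; last exact: measurable_cst.
    exact: measurable_realfun.measurable_funN.
  - apply: filterS fN => x; rewrite ler_norml => /andP[? ?].
    rewrite ler_pdivrMr// mul1r; apply/andP; split; last by minmax; lra.
    by apply: divr_ge0; [minmax; lra|exact: ltW].
  exists a, b; split => //; apply: filterS2 Ea Eb => x -> ->.
  rewrite -mulrBl mulrCA divff ?gt_eqF// mulr1.
  by minmax; lra.
have [||a [b [Ha Hb Eab]]] := part (rv u); first exact: measurable_rv.
  by apply: filterS uN => x [].
have [||c [d [Hc Hd Ecd]]] := part (iv u); first exact: measurable_iv.
  by apply: filterS uN => x [].
exists N, a, b, c, d; split => //.
have E1 : AE x : R, repr (rcst N * (a - b)) x = (N * (rv a x - rv b x))%:C.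
  apply: filterS5 Ha Hb (Linf_reprM (rcst N) (a - b)) (Linf_repr_cst N%:C) (Linf_reprB a b).
  move=> x [ia _] [ib _] -> -> ->; move: ia ib; rewrite /iv /rv => ia ib.
  by apply: complex_eq; rewrite ?ReM ?ImM ?ReD ?ImD ?ReN ?ImN ?ia ?ib/=; lra.
have E2 : AE x : R, repr (rcst N * (c - d)) x = (N * (rv c x - rv d x))%:C.
  apply: filterS5 Hc Hd (Linf_reprM (rcst N) (c - d)) (Linf_repr_cst N%:C) (Linf_reprB c d).
  move=> x [ia _] [ib _] -> -> ->; move: ia ib; rewrite /iv /rv => ia ib.
  by apply: complex_eq; rewrite ?ReM ?ImM ?ReD ?ImD ?ReN ?ImN ?ia ?ib/=; lra.
apply/Linf_eqP.
have E3 : AE x : R, repr (rcst N * (a - b) + icst * (rcst N * (c - d))) x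
    = (N * (rv a x - rv b x))%:C + 'i%C * (N * (rv c x - rv d x))%:C.
  apply: filterS5 E1 E2 (Linf_reprD (rcst N * (a - b)) (icst * (rcst N * (c - d))))
    (Linf_reprM icst (rcst N * (c - d))) (Linf_repr_cst 'i%C).
  by move=> x <- <- -> -> ->.
apply: filterS3 E3 Eab Ecd => x -> <- <-; rewrite /rv /iv.
by apply: complex_eq; rewrite ?ReD ?ImD ?ReM ?ImM /=; lra.
Qed.

Lemma ge0_decompose u : Linf_ge0 u -> exists N a, [/\ 0 < N, pos_ball a & u = rcst N * a].
Proof.
move=> Hu; pose N := Linf_norm u + 1; have N0 : 0 < N.
  by rewrite /N ltr_wpDl// Linf_norm_ge0.
have uN : AE x : R, rv u x <= N.
  by apply/ge0_norm_leP => //; rewrite /N lerDl ler01.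
have [||a Ha Ea] := @pos_ball_exists R (fun x => rv u x / N).
- by apply: measurable_realfun.measurable_funM; [exact: measurable_rv|exact: measurable_cst].
- apply: filterS2 Hu uN => x [_ u0] uN.
  rewrite ler_pdivrMr// mul1r uN andbT.
  by apply: divr_ge0 => //; exact: ltW.
exists N, a; split => //.
apply/Linf_eqP.
apply: filterS5 Hu Ha Ea (Linf_reprM (rcst N) a) (Linf_repr_cst N%:C).
rewrite /iv /rv => x [iu _] [ia _] Ea -> ->.
apply: complex_eq; rewrite ?ReM ?ImM ?ia ?iu /=; last by lra.
by rewrite Ea mulrCA divff ?gt_eqF//; lra.
Qed.

Lemma Linf_conjE u v : (AE x : R, repr v x = conjc (repr u x)) -> Linf_conj u = v.
Proof.
by move=> H; apply/Linf_eqP; apply: filterS2 H (Linf_repr_conj u) => x -> ->.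
Qed.

Lemma Linf_conjD u v : Linf_conj (u + v) = Linf_conj u + Linf_conj v.
Proof.
apply: Linf_conjE.
apply: filterS5 (Linf_reprD u v) (Linf_reprD (Linf_conj u) (Linf_conj v))
  (Linf_repr_conj u) (Linf_repr_conj v) Linf_repr0 => x -> -> -> -> _.
by apply: complex_eq; rewrite !(ReD, ImD); case: (repr u x) => ? ?; case: (repr v x) => ? ? /=; lra.
Qed.

Lemma Linf_conjM u v : Linf_conj (u * v) = Linf_conj u * Linf_conj v.
Proof.
apply: Linf_conjE.
apply: filterS4 (Linf_reprM u v) (Linf_reprM (Linf_conj u) (Linf_conj v))
  (Linf_repr_conj u) (Linf_repr_conj v) => x -> -> -> ->.
by apply: complex_eq; rewrite !(ReM, ImM); case: (repr u x) => ? ?; case: (repr v x) => ? ? /=; lra.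
Qed.

Lemma Linf_conj_pos_ball u : pos_ball u -> Linf_conj u = u.
Proof.
move=> Hu; apply: Linf_conjE; apply: filterS Hu => x [+ _]; rewrite /iv.
by case: (repr u x) => p q /= ->; rewrite oppr0.
Qed.

Lemma Linf_conj_cst (z : R[i]) : Linf_conj (Linf_cst z) = Linf_cst (conjc z).
Proof.
apply: Linf_conjE.
by apply: filterS2 (Linf_repr_cst z) (Linf_repr_cst (conjc z)) => x -> ->.
Qed.

Lemma Linf_conj_rcst t : Linf_conj (rcst t) = rcst t.
Proof. by rewrite Linf_conj_cst /conjc /= oppr0. Qed.
Lemma Linf_conj_icst : Linf_conj icst = - icst.
Proof.
rewrite Linf_conj_cst /icst -rmorphN; congr Linf_cst.
by apply: complex_eq => /=; lra.
Qed.
Lemma Linf_conjN u : Linf_conj (- u) = - Linf_conj u.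
Proof.
rewrite -[- u]mulN1r Linf_conjM -[RHS]mulN1r; congr (_ * _).
rewrite -(rmorph1 (@Linf_cst R)) -rmorphN Linf_conj_cst; congr Linf_cst.
by apply: complex_eq => /=; lra.
Qed.

(** The norm in terms of the *-algebra and the order. *)
Lemma Linf_norm_le_ge0 u r : 0 <= r ->
  Linf_norm u <= r <-> Linf_ge0 (rcst (r ^+ 2) - u * Linf_conj u).
Proof.
move=> r0.
have E : AE x : R, repr (rcst (r ^+ 2) - u * Linf_conj u) x
    = (r ^+ 2 - Normc.normc (repr u x) ^+ 2)%:C.
  apply: filterS4 (Linf_reprB (rcst (r ^+ 2)) (u * Linf_conj u))
    (Linf_repr_cst (r ^+ 2)%:C) (Linf_reprM u (Linf_conj u)) (Linf_repr_conj u).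
  move=> x -> -> -> ->; case: (repr u x) => p q /=.
  rewrite sqr_sqrtr ?addr_ge0 ?sqr_ge0//.
  by apply: complex_eq; rewrite !(ReD, ImD, ReN, ImN, ReM, ImM) /=; lra.
have H x : (Normc.normc (repr u x) <= r) = (0 <= r ^+ 2 - Normc.normc (repr u x) ^+ 2).
  by rewrite subr_ge0 ler_pXn2r// nnegrE// (normr_ge0 (repr u x : Rcomplex R)).
rewrite Linf_norm_le; split=> K.
  by apply: filterS2 K E => x; rewrite /iv /rv H => + ->.
by apply: filterS2 K E => x; rewrite /iv /rv H => + e; rewrite e => -[].
Qed.
End Extension.

(** * Complex-linear extension of an isometry of the positive unit ball *)

Section RingIdentities.
Variable A : comNzRingType.
Implicit Types n t s i a b c d p q r w : A.

Lemma dec_addE n t s i a b c d a' b' c' d' :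
  n * t * (a - b) + i * (n * t * (c - d)) + (n * s * (a' - b') + i * (n * s * (c' - d')))
  = n * (t * a + s * a' - (t * b + s * b')) + i * (n * (t * c + s * c' - (t * d + s * d'))).
Proof. by ring. Qed.

Lemma dec_oppE n i a b c d :
  - (n * (a - b) + i * (n * (c - d))) = n * (b - a) + i * (n * (d - c)).
Proof. by ring. Qed.

Lemma dec1E i a : a = 1 * (a - 0) + i * (1 * (0 - 0)).
Proof. by ring. Qed.

Lemma dec_scaleE t n i a b c d :
  t * (n * (a - b) + i * (n * (c - d))) = t * n * (a - b) + i * (t * n * (c - d)).
Proof. by ring. Qed.

Lemma dec_iE n i a b c d : i * i = -1 ->
  i * (n * (a - b) + i * (n * (c - d))) = n * (d - c) + i * (n * (a - b)).
Proof. by move=> ii; rewrite mulrDr [i * (i * _)]mulrA ii; ring. Qed.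

Lemma dec_mulE n i a b c d w :
  (n * (a - b) + i * (n * (c - d))) * w =
  n * (a * w - b * w) + i * (n * (c * w - d * w)).
Proof. by ring. Qed.

Lemma dec_mulE' n i a b c d w :
  w * (n * (a - b) + i * (n * (c - d))) =
  n * (w * a - w * b) + i * (n * (w * c - w * d)).
Proof. by ring. Qed.

Lemma dec_conjE n i a b c d :
  n * (a + - b) + - i * (n * (c + - d)) = n * (a - b) + i * (n * (d - c)).
Proof. by ring. Qed.

Lemma dec_divE q n i a b c d : q * n = 1 ->
  q * (n * (a - b) + i * (n * (c - d))) = (a - b) + i * (c - d).
Proof. by move=> qn; rewrite -[RHS]mul1r -qn; ring. Qed.
End RingIdentities.

Section Graph.
Context {R : realType} (Phi : Linf R -> Linf R).
Hypothesis HPhi : ball_isometry Phi.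
Local Notation L := (Linf R).
Implicit Types u v w a b c d : L.

Let PB u : pos_ball u -> pos_ball (Phi u). Proof. by case: HPhi => H *; exact: H. Qed.
Let P0 : Phi 0 = 0. Proof. by case: HPhi. Qed.

(** The graph of the complex-linear extension of Phi: decompose u into elements of
    the positive unit ball and apply Phi to each of them. *)
Definition ext_graph u v := exists N a b c d,
  [/\ 0 < N, pos_ball a /\ pos_ball b, pos_ball c /\ pos_ball d,
      u = rcst N * (a - b) + icst * (rcst N * (c - d)) &
      v = rcst N * (Phi a - Phi b) + icst * (rcst N * (Phi c - Phi d))].

Let comb t s a b : 0 <= t -> 0 <= s -> t + s = 1 -> pos_ball a -> pos_ball b ->
  pos_ball (rcst t * a + rcst s * b) /\
  Phi (rcst t * a + rcst s * b) = rcst t * Phi a + rcst s * Phi b.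
Proof.
move=> t0 s0 ts Ha Hb.
have t01 : 0 <= t <= 1 by lra.
have s01 : 0 <= s <= 1 by lra.
have Hta := pos_ball_cstM _ _ t01 Ha; have Hsb := pos_ball_cstM _ _ s01 Hb.
have H : pos_ball (rcst t * a + rcst s * b).
  apply: filterS4 (filterI Hta Hsb) (filterI (rv_cstM _ _ t01 Ha) (rv_cstM _ _ s01 Hb))
    (filterI Ha Hb) (Linf_reprD (rcst t * a) (rcst s * b)).
  move=> x [[ia _] [ib _]] [Ea Eb] [[_ /andP[? ?]] [_ /andP[? ?]]].
  move: ia ib Ea Eb; rewrite /iv /rv /rcst => ia ib Ea Eb ->.
  rewrite ImD ReD ia ib Ea Eb addr0; split => //; apply/andP; split; nra.
split => //.
by rewrite (ball_isometryD _ HPhi _ _ Hta Hsb H) !(ball_isometryZ _ HPhi).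
Qed.

Lemma ext_graphD u v u' v' : ext_graph u v -> ext_graph u' v' ->
  ext_graph (u + u') (v + v').
Proof.
move=> [N [a [b [c [d [N0 [Ha Hb] [Hc Hd] -> ->]]]]]].
move=> [M [a' [b' [c' [d' [M0 [Ha' Hb'] [Hc' Hd'] -> ->]]]]]].
have S0 : 0 < N + M by rewrite addr_gt0.
have t0 : 0 <= N / (N + M) by rewrite divr_ge0 // ltW.
have s0 : 0 <= M / (N + M) by rewrite divr_ge0 // ltW.
have ts : N / (N + M) + M / (N + M) = 1 by rewrite -mulrDl divff// gt_eqF.
have EN : rcst N = rcst (N + M) * rcst (N / (N + M)).
  by rewrite -rcstM mulrCA divff ?gt_eqF// mulr1.
have EM : rcst M = rcst (N + M) * rcst (M / (N + M)).
  by rewrite -rcstM mulrCA divff ?gt_eqF// mulr1.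
have [Ba Ea] := comb _ _ _ _ t0 s0 ts Ha Ha'.
have [Bb Eb] := comb _ _ _ _ t0 s0 ts Hb Hb'.
have [Bc Ec] := comb _ _ _ _ t0 s0 ts Hc Hc'.
have [Bd Ed] := comb _ _ _ _ t0 s0 ts Hd Hd'.
exists (N + M); do 4 eexists; split; [exact: S0|split;[exact: Ba|exact: Bb]|split;[exact: Bc|exact: Bd]|..].
  by rewrite EN EM; exact: dec_addE.
by rewrite Ea Eb Ec Ed EN EM; exact: dec_addE.
Qed.

Lemma ext_graphN u v : ext_graph u v -> ext_graph (- u) (- v).
Proof.
move=> [N [a [b [c [d [N0 [Ha Hb] [Hc Hd] -> ->]]]]]].
by exists N, b, a, d, c; split => //; exact: dec_oppE.
Qed.

Lemma ext_graphB u v u' v' : ext_graph u v -> ext_graph u' v' ->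
  ext_graph (u - u') (v - v').
Proof. by move=> H1 /ext_graphN; exact: ext_graphD. Qed.

Lemma ext_graph_pos_ball a : pos_ball a -> ext_graph a (Phi a).
Proof.
move=> Ha; have B0 := @pos_ball0 R; exists 1, a, 0, 0, 0; split => //.
  by rewrite rcst1; exact: dec1E.
by rewrite rcst1 P0; exact: dec1E.
Qed.

Lemma ext_graph0 : ext_graph 0 0.
Proof. by rewrite -{2}P0; apply: ext_graph_pos_ball; exact: pos_ball0. Qed.

Lemma ext_graph_rcst t u v : ext_graph u v -> ext_graph (rcst t * u) (rcst t * v).
Proof.
wlog t0 : t u v / 0 <= t => [H|].
  move=> uv; case: (leP 0 t) => t0; first exact: H.
  have -> : t = - - t by rewrite opprK.
  have E w : rcst (- - t) * w = - (rcst (- t) * w).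
    by rewrite /rcst [in LHS]rmorphN rmorphN mulNr.
  by rewrite !E; apply/ext_graphN/H => //; rewrite oppr_ge0 ltW.
rewrite le_eqVlt in t0; case/orP: t0 => [/eqP <-|t0].
  by move=> _; rewrite rcst0 !mul0r; exact: ext_graph0.
move=> [N [a [b [c [d [N0 [Ha Hb] [Hc Hd] -> ->]]]]]].
exists (t * N), a, b, c, d; split => //; first by rewrite mulr_gt0.
  by rewrite rcstM; exact: dec_scaleE.
by rewrite rcstM; exact: dec_scaleE.
Qed.

Lemma ext_graph_icst u v : ext_graph u v -> ext_graph (icst * u) (icst * v).
Proof.
move=> [N [a [b [c [d [N0 [Ha Hb] [Hc Hd] -> ->]]]]]].
by exists N, d, c, a, b; split => //; exact: dec_iE icst2.
Qed.

Lemma ext_graphZ (z : R[i]) u v : ext_graph u v -> ext_graph (z *: u) (z *: v).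
Proof.
move=> uv; have E w : z *: w = rcst (complex.Re z) * w + icst * (rcst (complex.Im z) * w).
  rewrite Linf_scaleE mulrA -mulrDl; congr (_ * _).
  rewrite /icst /rcst -rmorphM -rmorphD; congr Linf_cst.
  by apply: complex_eq; rewrite !(ReD, ImD, ReM, ImM) /=; lra.
rewrite !E; apply: ext_graphD; first exact: ext_graph_rcst.
by apply: ext_graph_icst; exact: ext_graph_rcst.
Qed.

Lemma ext_graph_total u : exists v, ext_graph u v.
Proof.
have [N [a [b [c [d [N0 Hab Hcd ->]]]]]] := Linf_decompose u.
by eexists; exists N, a, b, c, d; split.
Qed.

Lemma ext_graph0_uniq v : ext_graph 0 v -> v = 0.
Proof.
move=> [N [a [b [c [d [N0 [Ha Hb] [Hc Hd] E ->]]]]]].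
have E' : 0 = (a - b) + icst * (c - d).
  have Ninv : rcst N^-1 * rcst N = 1 by rewrite -rcstM mulVf ?gt_eqF// rcst1.
  by rewrite -(dec_divE _ _ _ icst a b c d Ninv) -E mulr0.
have H : AE x : R, repr a x = repr b x /\ repr c x = repr d x.
  have T : AE x : R, repr (a - b + icst * (c - d)) x =
      (repr a x - repr b x) + 'i%C * (repr c x - repr d x).
    apply: filterS5 (Linf_reprD (a - b) (icst * (c - d))) (Linf_reprM icst (c - d))
      (Linf_repr_cst 'i%C) (Linf_reprB a b) (Linf_reprB c d).
    by move=> x -> -> -> -> ->.
  rewrite -E' in T.
  apply: filterS4 (filterI Ha Hb) (filterI Hc Hd) T Linf_repr0.
  move=> x; rewrite /iv => -[[ia _] [ib _]] [[ic _] [idd _]] -> e.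
  have eR := congr1 (@complex.Re R) e; have eI := congr1 (@complex.Im R) e.
  move: eR eI; rewrite !(ReD, ImD, ReM, ImM, ReN, ImN) ia ib ic idd /= => eR eI.
  by split; apply: complex_eq; rewrite ?ia ?ib ?ic ?idd//; lra.
have -> : a = b by apply/Linf_eqP; apply: filterS H => x [].
have -> : c = d by apply/Linf_eqP; apply: filterS H => x [].
by rewrite !subrr !mulr0 addr0.
Qed.

(** The extension does not depend on the decomposition. *)
Lemma ext_graph_uniq u v v' : ext_graph u v -> ext_graph u v' -> v = v'.
Proof.
move=> H H'; have := ext_graphB _ _ _ _ H H'; rewrite subrr => /ext_graph0_uniq.
by move/eqP; rewrite subr_eq0 => /eqP.
Qed.

Lemma ext_graphM u v u' v' : ext_graph u v -> ext_graph u' v' ->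
  ext_graph (u * u') (v * v').
Proof.
move=> uv; have K a : pos_ball a -> ext_graph (u * a) (v * Phi a).
  case: uv => [N [p [b [c [d [N0 [Hp Hb] [Hc Hd] -> ->]]]]]] Ha.
  exists N, (p * a), (b * a), (c * a), (d * a).
  split => //; try by split; exact: pos_ballM.
    exact: dec_mulE.
  by rewrite !(ball_isometryM _ HPhi)//; exact: dec_mulE.
move=> [N [a [b [c [d [N0 [Ha Hb] [Hc Hd] -> ->]]]]]].
rewrite !dec_mulE'; apply: ext_graphD; last apply: ext_graph_icst;
  by apply: ext_graph_rcst; apply: ext_graphB; exact: K.
Qed.

Lemma ext_graph_conj u v : ext_graph u v -> ext_graph (Linf_conj u) (Linf_conj v).
Proof.
move=> [N [a [b [c [d [N0 [Ha Hb] [Hc Hd] -> ->]]]]]].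
have E (p q r s : L) : pos_ball p -> pos_ball q -> pos_ball r -> pos_ball s ->
    Linf_conj (rcst N * (p - q) + icst * (rcst N * (r - s))) =
    rcst N * (p - q) + icst * (rcst N * (s - r)).
  move=> Hp Hq Hr Hs.
  rewrite !(Linf_conjD, Linf_conjM, Linf_conjN, Linf_conj_rcst, Linf_conj_icst) !Linf_conj_pos_ball//.
  exact: dec_conjE.
exists N, a, b, d, c; split => //; rewrite E//; exact: PB.
Qed.

Lemma ext_graph_ge0 u v : ext_graph u v -> Linf_ge0 u -> Linf_ge0 v.
Proof.
move=> uv /ge0_decompose[N [a [N0 Ha E]]].
have := ext_graph_rcst N _ _ (ext_graph_pos_ball _ Ha); rewrite -E => /(ext_graph_uniq _ _ _ uv) ->.
apply: ge0M; last exact/pos_ball_ge0/PB.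
by apply: filterS (Linf_repr_cst N%:C) => x; rewrite /iv /rv => -> /=; rewrite ltW.
Qed.

Lemma ext_graph1 : ext_graph 1 1.
Proof. by rewrite -{2}(ball_isometry1 _ HPhi); apply: ext_graph_pos_ball; exact: pos_ball1. Qed.

Lemma ext_graph_norm u v : ext_graph u v -> Linf_norm v <= Linf_norm u.
Proof.
move=> uv; have r0 := Linf_norm_ge0 u.
apply/(Linf_norm_le_ge0 _ _ r0).
have H := (Linf_norm_le_ge0 u _ r0).1 (lexx _).
apply: ext_graph_ge0 H; apply: ext_graphB.
  by rewrite -[X in ext_graph X]mulr1 -[X in ext_graph _ X]mulr1; apply: ext_graph_rcst; exact: ext_graph1.
by apply: ext_graphM => //; exact: ext_graph_conj.
Qed.
End Graph.

Section Extend.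
Context {R : realType} (Phi : Linf R -> Linf R).
Hypothesis HPhi : ball_isometry Phi.
Local Notation L := (Linf R).

Lemma ball_isometry_inverse : exists2 Psi, ball_isometry Psi &
  forall u, pos_ball u -> Psi (Phi u) = u.
Proof.
have [PB Ps Pd P0] := HPhi.
have inj := ball_isometry_inj _ HPhi.
pose Psi (v : L) := xget 0 [set u | pos_ball u /\ Phi u = v].
have PsiP v : pos_ball v -> pos_ball (Psi v) /\ Phi (Psi v) = v.
  move=> /Ps[u Hu uv]; apply: (@xgetPex _ 0 [set u | pos_ball u /\ Phi u = v]).
  by exists u.
have PsiK u : pos_ball u -> Psi (Phi u) = u.
  by move=> Hu; have [H1 H2] := PsiP _ (PB _ Hu); exact: inj.
exists Psi => //; split.
- by move=> u /PsiP[].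
- by move=> u Hu; exists (Phi u); [exact: PB|exact: PsiK].
- move=> u v /PsiP[Hu Eu] /PsiP[Hv Ev].
  by rewrite -Pd// Eu Ev.
- by rewrite -[X in Psi X]P0 PsiK//; exact: pos_ball0.
Qed.

Theorem ball_isometry_extend : exists2 Lambda : L -> L,
  isometric_star_isomorphism Lambda & forall u, pos_ball u -> Lambda u = Phi u.
Proof.
have [Psi HPsi PsiK] := ball_isometry_inverse.
have [PB _ _ _] := HPhi.
have G_sym u v : ext_graph Phi u v -> ext_graph Psi v u.
  move=> [N [a [b [c [d [N0 [Ha Hb] [Hc Hd] Eu Ev]]]]]].
  exists N, (Phi a), (Phi b), (Phi c), (Phi d); split => //; try by split; exact: PB.
  by rewrite !PsiK.
have G_sym' u v : ext_graph Psi u v -> ext_graph Phi v u.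
  move=> [N [a [b [c [d [N0 [Ha Hb] [Hc Hd] Eu Ev]]]]]].
  have [QB Qs _ _] := HPsi.
  have PhiK w : pos_ball w -> Phi (Psi w) = w.
    move=> Hw; apply: (ball_isometry_inj _ HPsi) => //; first exact/PB/QB.
    by rewrite PsiK//; exact: QB.
  exists N, (Psi a), (Psi b), (Psi c), (Psi d); split => //; try by split; exact: QB.
  by rewrite !PhiK.
pose Lam u := xget 0 [set v | ext_graph Phi u v].
have LamP u : ext_graph Phi u (Lam u).
  exact: (@xgetPex _ 0 [set v | ext_graph Phi u v]) (ext_graph_total Phi u).
pose Lin v := xget 0 [set u | ext_graph Psi v u].
have LinP u : ext_graph Psi u (Lin u).
  exact: (@xgetPex _ 0 [set v | ext_graph Psi u v]) (ext_graph_total Psi u).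
have uq := ext_graph_uniq _ HPhi; have uq' := ext_graph_uniq _ HPsi.
exists Lam; last by move=> u Hu; apply: uq (LamP u) _; exact: ext_graph_pos_ball.
split.
- exists Lin => u.
    by apply: uq' (LinP _) _; exact: G_sym.
  by apply: uq (LamP _) _; exact: G_sym'.
- move=> z u v; apply: uq (LamP _) _.
  by apply: ext_graphD => //; exact: ext_graphZ.
- by move=> u v; apply: uq (LamP _) _; exact: ext_graphM.
- by move=> u; apply: uq (LamP _) _; exact: ext_graph_conj.
- move=> u; apply/eqP; rewrite eq_le.
  rewrite (ext_graph_norm _ HPhi _ _ (LamP u)).
  by rewrite (ext_graph_norm _ HPsi _ _ (G_sym _ _ (LamP u))).
Qed.
End Extend.

(** * Characters and the Gelfand transform *)

Section UltrafilterLimit.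

Lemma ultra_fmap {T U : Type} (f : T -> U) (F : set_system T) :
  UltraFilter F -> UltraFilter (f @ F).
Proof.
move=> FU; split; first exact: fmap_proper_filter.
move=> G GP FG; apply/seteqP; split => // A GA.
have [//|FnA] := in_ultra_setVsetC (f @^-1` A) FU.
have GnA : G (~` A) by exact: FG.
have GI : G (A `&` ~` A) by exact: (@filterI _ G _ _ _ GA GnA).
have [x [Ax nAx]] := @filter_ex _ G GP _ GI.
by case: nAx.
Qed.

(** A bounded real function converges along every ultrafilter. *)
Lemma ultra_bounded_cvg {R : realType} {T : Type} (F : set_system T)
    (f : T -> R) (M : R) :
  UltraFilter F -> F [set x | `|f x| <= M] -> exists l : R, f x @[x --> F] --> l.
Proof.
move=> FU fM.
have := @segment_compact R (- M) M; rewrite compact_ultra => /(_ (f @ F) (ultra_fmap f _ FU)).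
case.
  apply: filterS fM => x xM /=. rewrite in_itv.
  by rewrite /= -ler_norml; exact: xM.
by move=> l [_ Hl]; exists l.
Qed.
End UltrafilterLimit.

Section Gelfand.
Context {R : realType}.
Local Notation L := (Linf R).
Implicit Types u v w : L.

Lemma exists_character w : w <> 0 -> exists phi : L -> R[i]^o,
  character phi /\ phi w != 0.
Proof.
move=> w0.
pose eps := Linf_norm w / 2.
have w_gt0 : 0 < Linf_norm w.
  by rewrite lt_neqAle Linf_norm_ge0 andbT eq_sym; apply/eqP => /Linf_norm0_eq.
have eps0 : 0 < eps by rewrite divr_gt0.
pose E := [set x : R | eps < Normc.normc (repr w x)].
have nE : ~ AE x : R, ~ E x.
  move=> H; have : Linf_norm w <= eps.
    by apply/Linf_norm_le; apply: filterS H => x /negP; rewrite -leNgt.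
  by rewrite leNgt ltr_pdivrMr// mulr_natr mulr2n ltrDl w_gt0.
(* The filter generated by E and the conull sets. *)
pose G : set_system R := [set A | AE x : R, E x -> A x].
have GP : ProperFilter G.
  split.
    by move=> G0; apply: nE; move: (G0 : AE x : R, E x -> False); apply: filterS.
  split; first exact: aeW.
    move=> A B GA GB; move: (GA : AE x : R, E x -> A x) (GB : AE x : R, E x -> B x).
    by apply: filterS2 => x HA HB Ex; split; [exact: HA|exact: HB].
  move=> A B AB GA; move: (GA : AE x : R, E x -> A x).
  by apply: filterS => x HA Ex; exact/AB/HA.
have [U [UU GU]] := ultraFilterLemma GP.
have Uae (P : set R) : (AE x : R, P x) -> U P.
  by move=> HP; apply: GU; apply: filterS HP.
have UE : U E by apply: GU; apply: aeW.
have bnd u : U [set x | `|rv u x| <= Linf_norm u] /\ U [set x | `|iv u x| <= Linf_norm u].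
  have H := (Linf_norm_le u _).1 (lexx _).
  split; apply: Uae; apply: filterS H => x /=; rewrite /rv /iv; case: (repr u x) => p q /= H;
    (have S0 : 0 <= p ^+ 2 + q ^+ 2 by rewrite addr_ge0 ?sqr_ge0).
    by apply: le_trans H; rewrite -sqrtr_sqr ler_sqrt// lerDl sqr_ge0.
  by apply: le_trans H; rewrite -sqrtr_sqr ler_sqrt// lerDr sqr_ge0.
have limr u : {l : R | rv u x @[x --> U] --> l}.
  by apply: cid; exact: (ultra_bounded_cvg _ _ _ UU (bnd u).1).
have limi u : {l : R | iv u x @[x --> U] --> l}.
  by apply: cid; exact: (ultra_bounded_cvg _ _ _ UU (bnd u).2).
pose phi u : R[i]^o := sval (limr u) +i* sval (limi u).
(* The character is the limit along U of the representatives. *)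
have phiP u (a b : R) : rv u x @[x --> U] --> a -> iv u x @[x --> U] --> b -> phi u = a +i* b.
  move=> ua ub; rewrite /phi; congr (_ +i* _).
    by apply: cvg_unique (svalP (limr u)) ua; exact: norm_hausdorff.
  by apply: cvg_unique (svalP (limi u)) ub; exact: norm_hausdorff.
have eq_cvg (f g : R -> R) (l : R) : (AE x : R, f x = g x) -> g x @[x --> U] --> l -> f x @[x --> U] --> l.
  by move=> fg; apply: cvg_trans; apply: near_eq_cvg; apply: Uae; apply: filterS fg.
have Cr u := svalP (limr u); have Ci u := svalP (limi u).
have phiD u v : phi (u + v) = phi u + phi v.
  rewrite (phiP (u + v) (sval (limr u) + sval (limr v)) (sval (limi u) + sval (limi v)))//.
    apply: (eq_cvg _ (rv u \+ rv v)); last exact: cvgD.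
    by apply: filterS (Linf_reprD u v) => x; rewrite /rv => -> /=; rewrite ReD.
  apply: (eq_cvg _ (iv u \+ iv v)); last exact: cvgD.
  by apply: filterS (Linf_reprD u v) => x; rewrite /iv => -> /=; rewrite ImD.
have phiM u v : phi (u * v) = phi u * phi v.
  rewrite (phiP (u * v)
    (sval (limr u) * sval (limr v) - sval (limi u) * sval (limi v))
    (sval (limr u) * sval (limi v) + sval (limi u) * sval (limr v)))//.
    apply: (eq_cvg _ (rv u \* rv v \- iv u \* iv v)); last by apply: cvgB; exact: cvgM.
    by apply: filterS (Linf_reprM u v) => x; rewrite /rv /iv => -> /=; rewrite ReM.
  apply: (eq_cvg _ (rv u \* iv v \+ iv u \* rv v)); last by apply: cvgD; exact: cvgM.
  by apply: filterS (Linf_reprM u v) => x; rewrite /rv /iv => -> /=; rewrite ImM.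
have phiC (z : R[i]) : phi (Linf_cst z) = z.
  rewrite (phiP (Linf_cst z) (complex.Re z) (complex.Im z)); first by case: z.
    by apply: (eq_cvg _ (cst (complex.Re z))); [apply: filterS (Linf_repr_cst z) => x; rewrite /rv => ->|exact: cvg_cst].
  by apply: (eq_cvg _ (cst (complex.Im z))); [apply: filterS (Linf_repr_cst z) => x; rewrite /iv => ->|exact: cvg_cst].
exists phi; split.
  split => //.
    by move=> z u v; rewrite phiD Linf_scaleE phiM phiC.
  by exists 1; rewrite -(rmorph1 (@Linf_cst R)) phiC oner_eq0.
apply/eqP => phiw0.
have [r0 i0] : sval (limr w) = 0 /\ sval (limi w) = 0 by case: phiw0.
have H : rv w x * rv w x + iv w x * iv w x @[x --> U] --> (0 : R).
  rewrite [X in _ --> X](_ : _ = sval (limr w) * sval (limr w) + sval (limi w) * sval (limi w)).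
    by apply: cvgD; exact: cvgM.
  by rewrite r0 i0 mulr0 addr0.
have : eps ^+ 2 <= 0.
  apply: (cvgr_to_ge H); apply: filterS UE => x; rewrite /E /rv /iv /=.
  case: (repr w x) => p q /= H'.
  have S0 : 0 <= p ^+ 2 + q ^+ 2 by rewrite addr_ge0 ?sqr_ge0.
  rewrite -!expr2 -(sqr_sqrtr S0) ler_pXn2r ?nnegrE ?sqrtr_ge0//.
    exact: ltW.
  exact: ltW.
by rewrite leNgt exprn_gt0.
Qed.

Lemma gelfand_inj : injective (@gelfand R).
Proof.
move=> u v E; apply: contrapT => uv.
have [|phi [cphi /eqP]] := exists_character (u - v); first by move/eqP; rewrite subr_eq0 => /eqP.
apply; have [lphi _ _] := cphi.
pose f : max_ideal_space R := exist _ (phi : {ptws L -> R[i]^o}) (mem_set cphi).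
have Euv : phi u = phi v.
  by have : gelfand u f = gelfand v f by rewrite E.
have -> : u - v = (-1) *: v + u by rewrite scaleN1r addrC.
by rewrite lphi Euv scaleN1r addNr.
Qed.

Lemma gelfandK : cancel (@gelfand R) (@gelfand_inv R).
Proof.
by move=> u; apply: pinvKV; rewrite ?in_setT// => x y _ _; exact: gelfand_inj.
Qed.

(** Precomposing characters with a map of L^oo is continuous, since evaluation at u
    becomes evaluation at Lam u. *)
Lemma gelfand_precomp_continuous (Lam : L -> L)
    (f : max_ideal_space R -> max_ideal_space R) :
  (forall phi u, set_val (f phi) u = set_val phi (Lam u)) -> continuous f.
Proof.
move=> Hf; apply: continuous_comp_initial => phi.
have F0 : Filter (nbhs phi) := nbhs_filter phi.
have FF : Filter (fmap (set_val \o f) (nbhs phi)) := fmap_filter _ F0.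
rewrite /continuous_at.
apply: (proj2 (@cvg_sup _ _ _ _ _ FF)) => u A /= [_ [[W oW <-]] Wf sWA].
have cu := @gelfand_continuous R (Lam u) phi.
have : nbhs phi ((fun psi : max_ideal_space R => set_val psi (Lam u)) @^-1` W).
  apply: cu; apply: open_nbhs_nbhs; split => //.
  by rewrite -Hf; exact: Wf.
apply: filterS => psi Wpsi; apply: sWA.
by move: Wpsi; rewrite /= -Hf.
Qed.

(** tau precomposes characters with Lam, so gelfand u o tau is gelfand (Lam u). *)
Theorem gelfand_star_isomorphism (Lam : L -> L) : isometric_star_isomorphism Lam ->
  exists tau : continuousType (max_ideal_space R) (max_ideal_space R),
    homeomorphism tau /\ (forall u, Lam u = gelfand_inv (gelfand u \o tau)).
Proof.
move=> [[Lin K1 K2] lin mult _ _].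
have comp (M : L -> L) (N : L -> L) : linear M -> {morph M : u v / u * v} -> cancel N M ->
    forall phi : max_ideal_space R, character (set_val phi \o M : {ptws L -> R[i]^o}).
  move=> lM mM K [phi /= Hphi]; have [l m [u u0]] := set_mem Hphi; split.
  - by move=> z a b /=; rewrite lM; exact: l.
  - by move=> a b /=; rewrite mM; exact: m.
  - by exists (N u); rewrite /= K; exact: u0.
have linI : linear Lin by move=> z u v; apply: (can_inj K1); rewrite lin !K2.
have multI : {morph Lin : u v / u * v} by move=> u v; apply: (can_inj K1); rewrite mult !K2.
pose tau (phi : max_ideal_space R) : max_ideal_space R :=
  exist _ (set_val phi \o Lam : {ptws L -> R[i]^o}) (mem_set (comp _ _ lin mult K2 phi)).
pose sig (phi : max_ideal_space R) : max_ideal_space R :=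
  exist _ (set_val phi \o Lin : {ptws L -> R[i]^o}) (mem_set (comp _ _ linI multI K1 phi)).
have ct : continuous tau by exact: (gelfand_precomp_continuous Lam).
have cs : continuous sig by exact: (gelfand_precomp_continuous Lin).
exists (mkcts ct); split.
  split => //; exists sig; split => // phi; apply: val_inj; apply/funext => u.
    exact: (congr1 (set_val phi) (K2 u)).
  exact: (congr1 (set_val phi) (K1 u)).
move=> u; rewrite -[LHS]gelfandK; congr gelfand_inv.
by apply/continuousEP => phi.
Qed.
End Gelfand.

(** * Lipschitz functions have bounded densities *)

Lemma bounded_integrable_itv {R : realType} (g : R -> R) (M a b : R) :
  measurable_fun `[a, b] g -> (forall x, `|g x| <= M) ->
  (@lebesgue_measure R).-integrable `[a, b] (EFin \o g).
Proof.
move=> mg gM; apply: measurable_bounded_integrable => //.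
  have := @lebesgue_measure_itv R `[a, b]; rewrite /= => ->.
  by case: ifP => _; rewrite ?ltry// -EFinB ltry.
exists M; split; first exact: num_real.
by move=> N MN x _ /=; apply: ltW; apply: le_lt_trans MN.
Qed.

Section LipschitzDensity.
Context {R : realType}.
Local Notation leb := (@lebesgue_measure R).
Variables (F : R -> R) (K : R).
Hypotheses (K0 : 0 < K) (FK : forall x y, `|F x - F y| <= K * `|x - y|).

(** For s = 1 and s = -1 these functions are nondecreasing with sum 2 K x. *)
Let G (s : R) x := K * x + s * F x.

Let G_nd s : `|s| = 1 -> {homo G s : x y / x <= y}.
Proof.
move=> s1 x y xy; rewrite /G -subr_ge0.
have := FK y x; rewrite (ger0_norm (x := y - x)) ?subr_ge0// => H.
have : `|s * (F y - F x)| <= K * (y - x) by rewrite normrM s1 mul1r.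
by rewrite ler_norml => /andP[H1 H2]; lra.
Qed.

Let G_rc s : right_continuous (G s).
Proof.
apply: right_continuousW => x; apply: cvgD.
  by apply: cvgM; [exact: cvg_cst|exact: cvg_id].
apply: cvgM; first exact: cvg_cst.
apply/cvgrPdist_le => e e0; near=> y.
apply: le_trans (FK _ _) _.
rewrite -ler_pdivlMl// mulrC; near: y.
by apply: cvgr_dist_le => //; rewrite divr_gt0.
Unshelve. all: by end_near. Qed.

HB.instance Definition _ (s : {s : R | `|s| = 1}) :=
  isCumulative.Build R _ R (G (sval s)) (G_nd (sval s) (svalP s)) (G_rc (sval s)).

Let Gc (s : {s : R | `|s| = 1}) : cumulative R R := G (sval s).
Let s1 : {s : R | `|s| = 1} := exist _ 1 (@normr1 R).
Let sN1 : {s : R | `|s| = 1} := exist _ (-1) (etrans (@normrN1 R) erefl).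

Let mu (s : {s : R | `|s| = 1}) := lebesgue_stieltjes_measure (Gc s).

Let mu_oc s (a b : R) : a <= b -> mu s `]a, b]%classic = (G (sval s) b - G (sval s) a)%:E.
Proof.
move=> ab; rewrite /mu /lebesgue_stieltjes_measure /measure_extension.
rewrite measurable_mu_extE /=; last exact: is_ocitv.
by rewrite wlength_itv_bnd.
Qed.

(** The Stieltjes measures of the two functions add up to 2 K times the Lebesgue
    measure. *)
Let mu_le (A : set (measurableTypeR R)) : measurable A ->
  (mu s1 A <= (2 * K)%:E * leb A)%E.
Proof.
move=> mA.
have k0 : 0 <= (2 * K)^-1 by rewrite invr_ge0 mulr_ge0// ltW.
pose m := mscale (NngNum k0) (measure_add (mu s1) (mu sN1)).
have mE B : m B = (((2 * K)^-1)%:E * (mu s1 B + mu sN1 B))%E.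
  by rewrite -(measure_addE (mu s1) (mu sN1)).
have E : leb A = m A.
  apply: lebesgue_measure_unique => // X /ocitvP[->|[[a b] /= ab ->]].
    by rewrite !measure0.
  apply: etrans _ (esym (mE _)); rewrite !mu_oc ?ltW//.
  rewrite lebesgue_measure_itv /= lte_fin ab; congr EFin.
  by rewrite /G /=; field; rewrite ?gt_eqF//.
rewrite E mE muleA -EFinM divff; last by rewrite mulf_neq0 ?gt_eqF.
by rewrite mul1e leeDl.
Qed.

Lemma lipschitz_density : exists g : R -> R, [/\ measurable_fun setT g,
  forall x, `|g x| <= K & forall t, 0 <= t <= 1 ->
    F t - F 0 = \int[leb]_(x in `[0, t]) g x].
Proof.
pose J : set (measurableTypeR R) := `[(0:R), 1]%classic.
have mI : measurable J by exact: measurable_itv.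
have leb1 : leb J = 1%E.
  by rewrite /J lebesgue_measure_itv /= lte01 oppr0 adde0.
have fin : (mu s1 J < +oo)%E.
  apply: le_lt_trans (mu_le _ mI) _; by rewrite leb1 mule1 ltry.
pose nu := mfrestr mI fin.
have nuleb : nu `<< leb.
  apply/null_content_dominatesP => A mA A0.
  have mAI : measurable (A `&` J) by exact: measurableI.
  apply/eqP; rewrite -measure_le0; apply: le_trans (mu_le _ mAI) _.
  have : (leb (A `&` J) <= 0)%E by rewrite -A0; apply: le_measure; rewrite ?inE.
  by rewrite measure_le0 => /eqP ->; rewrite mule0.
have [f [f0 ffin fint fE]] := @radon_nikodym_sigma_finite _ _ R leb nu nuleb.
have {}fE (B : set (measurableTypeR R)) : measurable B ->
    mu s1 (B `&` J) = (\int[leb]_(x in B) f x)%E by exact: fE.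
have mf : measurable_fun setT f by exact: measurable_int fint.
(* The density is at most 2 K almost everywhere on [0,1]. *)
pose A := [set x | ((2 * K)%:E < f x)%E] `&` J.
have mA : measurable (A : set (measurableTypeR R)).
  apply: measurableI => //; rewrite -[X in measurable X]setTI.
  exact: measurable_realfun.emeasurable_fun_o_infty.
have A0 : leb A = 0%E.
  have lebA : (leb A < +oo)%E.
    apply: le_lt_trans (_ : leb J < +oo)%E.
      by apply: le_measure; rewrite ?inE//; exact: subIsetr.
    by rewrite leb1 ltry.
  have E1 : mu s1 (A `&` J) = ((2 * K)%:E * leb A + \int[leb]_(x in A) (f x - (2 * K)%:E))%E.
    rewrite fE// -integral_cst// -ge0_integralD//.
    - by apply: eq_integral => x _; rewrite /cst [RHS]addeC subeK.
    - by move=> x _; rewrite lee_fin mulr_ge0// ltW.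
    - by move=> x [fx _]; rewrite sube_ge0 ?ltW.
    - apply: emeasurable_funB => //; exact: measurable_funTS.
  have E2 : (mu s1 (A `&` J) <= (2 * K)%:E * leb A)%E.
    rewrite (_ : A `&` _ = A); first exact: mu_le.
    by rewrite /A -setIA setIid.
  have fin2 : ((2 * K)%:E * leb A)%E \is a fin_num.
    by rewrite fin_numM// ge0_fin_numE.
  have I0 : (\int[leb]_(x in A) `|f x - (2 * K)%:E| = 0)%E.
    have -> : (\int[leb]_(x in A) `|f x - (2 * K)%:E| = \int[leb]_(x in A) (f x - (2 * K)%:E))%E.
      apply: eq_integral => x; rewrite inE => -[fx _].
      by rewrite gee0_abs// sube_ge0 ?ltW.
    apply/eqP; rewrite eq_le; apply/andP; split.
      by move: E2; rewrite E1 -[leRHS]adde0 leeD2lE.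
    by apply: integral_ge0 => x [fx _]; rewrite sube_ge0 ?ltW.
  have /(ae_eq_integral_abs _ mA) : measurable_fun A (fun x => (f x - (2 * K)%:E)%E).
    by apply: emeasurable_funB => //; exact: measurable_funTS.
  move=> /(_ leb) [/(_ I0) H _].
  apply: measure_negligible => //.
  case: H => N [mN N0 sN]; exists N; split => //.
  move=> x Ax; apply: sN => /= /(_ Ax) fx.
  case: Ax => /= + _; rewrite -(fineK (ffin x)) lte_fin => Kfx.
  have fx' : fine (f x) - 2 * K = 0 :> R.
    by have := congr1 fine fx; rewrite -(fineK (ffin x)).
  by rewrite -subr_gt0 fx' ltxx in Kfx.
pose g x := Num.min (fine (f x)) (2 * K) - K.
have mg : measurable_fun setT g.
  apply: measurable_realfun.measurable_funB; last exact: measurable_cst.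
  apply: measurable_realfun.measurable_minr; last exact: measurable_cst.
  exact: measurableT_comp.
have gK x : `|g x| <= K.
  rewrite /g; have : 0 <= fine (f x) by exact: fine_ge0.
  move: (fine _) => y y0; move: K0 => K0'; rewrite ler_norml.
  by minmax; apply/andP; split; lra.
exists g; split => //.
move=> t /andP[t0 t1].
have mt : measurable (`[0, t]%classic : set (measurableTypeR R)) by exact: measurable_itv.
have lebt : leb `[0, t]%classic = t%:E.
  rewrite lebesgue_measure_itv /= lte_fin oppr0 adde0; case: ltP => // t0'.
  by congr EFin; apply/eqP; rewrite eq_le t0 t0'.
have E1 : (\int[leb]_(x in `[0%R, t]) (g x + K)%:E = (G 1 t - G 1 0)%:E)%E.
  rewrite -(mu_oc s1) //.
  have -> : mu s1 `]0, t]%classic = mu s1 (`]0, t]%classic `&` J).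
    congr (mu s1 _); apply/esym/setIidPl => x /=.
    by rewrite /J /= !in_itv /= => /andP[x0 xt]; rewrite (ltW x0) (le_trans xt).
  rewrite fE//.
  rewrite integral_itv_obnd_cbnd; last exact: measurable_funTS.
  apply: ae_eq_integral => //.
  - apply/measurable_EFinP; apply: measurable_realfun.measurable_funD; last exact: measurable_cst.
    exact: measurable_funTS.
  - exact: measurable_funTS.
  - exists A; split => // x /= /not_implyP[/= xt nE].
    split; last by move: xt => /=; rewrite /J /= !in_itv /= => /andP[x0 xt]; rewrite x0 (le_trans xt).
    apply: contrapT => /= /negP; rewrite -leNgt => fx; apply: nE.
    rewrite /g subrK min_l ?fineK// -lee_fin fineK//.
have Ig : leb.-integrable `[0, t]%classic (EFin \o g).
  by apply: bounded_integrable_itv gK; exact: measurable_funTS.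
have Ik : leb.-integrable `[0, t]%classic (EFin \o cst K).
  by apply: (bounded_integrable_itv _ K) => [|x]; rewrite /cst ?gtr0_norm//; exact: measurable_cst.
have E2 : \int[leb]_(x in `[0, t]) (g x + K) = G 1 t - G 1 0.
  by rewrite /Rintegral; have := congr1 fine E1.
have E3 : \int[leb]_(x in `[0, t]) (g x + K) = \int[leb]_(x in `[0, t]) g x + K * t.
  rewrite (RintegralD mt Ig Ik); congr (_ + _).
  rewrite (@Rintegral_cst _ _ _ leb _ mt); congr (_ * _).
  exact: (congr1 fine lebt).
apply: (addIr (K * t)); rewrite -E3 E2 /G; clear.
by ring.
Qed.
End LipschitzDensity.

(** * Primitives of bounded functions *)

Section Primitive.
Context {R : realType}.
Local Notation leb := (@lebesgue_measure R).

#[global] Instance leb_ae_filter : Filter (almost_everywhere leb).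
Proof. exact: ae_filter_ringOfSetsType. Qed.

(** Almost everywhere for the restricted measure, in terms of Lebesgue measure. *)
Lemma leb01_aeP (P : R -> Prop) : (AE x : R, P x) <->
  {ae leb, forall x : R, 0 <= x <= 1 -> P x}.
Proof.
have mI : measurable (`[(0:R), 1]%classic : set (measurableTypeR R)) by exact: measurable_itv.
split=> -[N [mN N0 sN]].
  exists (N `&` `[0, 1]%classic); split => //; first exact: measurableI.
  move=> x /= /not_implyP[x01 nP]; split; last by rewrite /= in_itv.
  exact: sN.
exists (N `|` ~` `[0, 1]%classic); split.
- by apply: measurableU => //; exact: measurableC.
- rewrite /leb01 /= /mrestr setIUl setICl setU0.
  apply/eqP; rewrite -measure_le0 -N0; apply: le_measure; rewrite ?inE//.
  exact: measurableI.
- move=> x /= nP; have [x01|x01] := boolP (0 <= x <= 1).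
    by left; apply: sN => /= /(_ x01).
  by right; rewrite /= in_itv /=; apply/negP.
Qed.

Section RealPrimitive.
Variables (v : R -> R) (M : R).
Hypotheses (mv : measurable_fun `[(0:R), 1] v) (vM : AE x : R, `|v x| <= M).

Let M0 : 0 <= M.
Proof. by have [x] := ae_exists _ vM; apply: le_trans. Qed.

(** v truncated to [-M, M] and extended by 0. *)
Let g : R -> R := (fun x => Num.max (- M) (Num.min M (v x))) \_ `[(0:R), 1].

Let gM x : `|g x| <= M.
Proof.
rewrite /g patchE; case: ifP => _; last by rewrite normr0.
by rewrite ler_norml le_max lexx /= ge_max ge_min lexx /= andbT (le_trans _ M0)// oppr_le0.
Qed.

Let mg : measurable_fun setT g.
Proof.
apply/(measurable_restrictT _ _).1 => //.
apply: measurable_realfun.measurable_maxr; first exact: measurable_cst.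
by apply: measurable_realfun.measurable_minr => //; exact: measurable_cst.
Qed.

Let gv : AE x : R, 0 <= x <= 1 -> g x = v x.
Proof.
apply: filterS vM => x; rewrite ler_norml => /andP[H1 H2] x01.
by rewrite /g patchE mem_set ?in_itv//= ?in_itv//= (min_r H2) max_r.
Qed.

Let Ig a b : leb.-integrable `[a, b] (EFin \o g).
Proof. by apply: bounded_integrable_itv gM; exact: measurable_funTS. Qed.

Let prim_eq t : t <= 1 -> \int[leb]_(x in `[0, t]) v x = \int[leb]_(x in `[0, t]) g x.
Proof.
move=> t1; congr fine; apply: ae_eq_integral => //.
- apply/measurable_EFinP; apply: measurable_funS mv => // x /=.
  by rewrite !in_itv /= => /andP[-> xt]; rewrite (le_trans xt).
- by apply/measurable_EFinP; exact: measurable_funTS.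
- move/leb01_aeP : gv; apply: filterS => x H /=; rewrite in_itv /= => /andP[x0 xt].
  have x01 : 0 <= x <= 1 by rewrite x0 (le_trans xt).
  by rewrite H.
Qed.

Lemma prim_lipschitz s t : 0 <= s <= 1 -> 0 <= t <= 1 ->
  `|\int[leb]_(x in `[0, s]) v x - \int[leb]_(x in `[0, t]) v x| <= M * `|s - t|.
Proof.
wlog ts : s t / t <= s.
  move=> H s01 t01; have [|st] := leP t s; first by move=> ?; exact: H.
  by rewrite distrC (distrC s); apply: H => //; exact: ltW.
move=> /andP[s0 s1] /andP[t0 t1]; rewrite !prim_eq//.
rewrite Rintegral_itvB//.
have mts : measurable (`]t, s]%classic : set (measurableTypeR R)) by exact: measurable_itv.
have Its : leb.-integrable `]t, s] (EFin \o g).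
  by apply: integrableS (Ig t s) => //; exact: subset_itv_oc_cc.
have Inorm : leb.-integrable `]t, s] (EFin \o (fun x => `|g x|)).
  by have := integrable_abse Its.
have Icst : leb.-integrable `]t, s] (EFin \o cst M).
  have cM (x : R) : `|cst M x| <= M by rewrite /cst ger0_norm.
  have := bounded_integrable_itv (cst M) M t s (measurable_cst _) cM.
  by apply: integrableS => //; exact: subset_itv_oc_cc.
apply: le_trans (le_normr_Rintegral mts Its) _.
apply: le_trans (le_Rintegral mts Inorm Icst _) _; first by move=> x _; exact: gM.
rewrite (@Rintegral_cst _ _ _ leb _ mts) ger0_norm ?subr_ge0// ler_wpM2l//.
have := @lebesgue_measure_itv R `]t, s]; rewrite /= => ->.
by case: ifP => _ //=; rewrite subr_ge0.
Qed.

(** Lebesgue differentiation: the derivative of a primitive on [0,1] of a bounded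
    function v is v almost everywhere. F is arbitrary outside [0,1]. *)
Lemma prim_derive (F : R -> R) (c : R) :
  (forall y, 0 <= y <= 1 -> F y = c + \int[leb]_(x in `[0, y]) v x) ->
  AE x : R, is_derive x (1 : R) F (v x).
Proof.
move=> FE; apply/leb01_aeP.
have lg : locally_integrable setT g.
  have := @integrable_locally_restrict R (fun x => Num.max (- M) (Num.min M (v x))) `[(0:R), 1].
  apply => //.
  have : leb.-integrable `[(0:R), 1] (EFin \o g) by exact: Ig.
  apply: eq_integrable => // x; rewrite inE /= => x01.
  by rewrite /g patchE mem_set.
have nset1 (a : R) : {ae leb, forall x : R, x != a}.
  exists [set a]; split; [exact: measurable_set1|exact: lebesgue_measure_set1|].
  by move=> x /= /negP; rewrite negbK => /eqP.
have n01 : {ae leb, forall x : R, x != 0 /\ x != 1}.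
  by apply: filterS2 (nset1 0) (nset1 1).
have H := @FTC1 R g (BLeft 0) (fun y => Ig 0 y) lg.
have gv' := (leb01_aeP _).1 gv.
apply: filterS3 H n01 gv' => x H [x0 x1] gvx x01.
have {}x0 : 0 < x by rewrite lt_neqAle eq_sym x0; case/andP: x01.
have {}x1 : x < 1 by rewrite lt_neqAle x1; case/andP: x01.
have [|Hd HE] := H; first by rewrite /= lte_fin.
(* FTC1 applies to g on all of [0,oo); near x in ]0,1[ its primitive is F - c. *)
have Hx : \forall y \near x, c + \int[leb]_(t in `[0, y]) g t = F y.
  near=> y.
  have y01 : 0 <= y <= 1.
    by apply/andP; split; apply: ltW; near: y; [exact: lt_nbhsr|exact: lt_nbhsl].
  by rewrite FE// prim_eq//; case/andP: y01.
rewrite -(gvx x01 x01).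
have HD : is_derive x (1:R) (fun y => c + \int[leb]_(t in `[0, y]) g t) (g x).
  have -> : g x = 0 + g x by rewrite add0r.
  apply: is_deriveD; rewrite -HE derive1E; exact: derivableP.
exact: near_eq_is_derive Hx HD.
Unshelve. all: by end_near. Qed.
End RealPrimitive.
End Primitive.

(** * Lipschitz functions as primitives of classes *)

Section LipPrimitive.
Context {R : realType}.
Local Notation leb := (@lebesgue_measure R).
Local Notation L := (Linf R).
Implicit Types (u v : L) (f g : Lip R) (z c : R[i]).

Lemma normc_Re z : `|complex.Re z| <= Normc.normc z.
Proof.
case: z => p q /=; have S0 : 0 <= p ^+ 2 + q ^+ 2 by rewrite addr_ge0 ?sqr_ge0.
by rewrite -sqrtr_sqr ler_sqrt// lerDl sqr_ge0.
Qed.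

Lemma normc_Im z : `|complex.Im z| <= Normc.normc z.
Proof.
case: z => p q /=; have S0 : 0 <= p ^+ 2 + q ^+ 2 by rewrite addr_ge0 ?sqr_ge0.
by rewrite -sqrtr_sqr ler_sqrt// lerDr sqr_ge0.
Qed.

Lemma normc_le_ReIm z : Normc.normc z <= `|complex.Re z| + `|complex.Im z|.
Proof.
have -> : Normc.normc z = Normc.normc ((complex.Re z)%:C + (0 +i* complex.Im z)).
  by congr Normc.normc; apply: complex_eq => /=; rewrite ?addr0 ?add0r.
apply: le_trans (le_normcD (_ : Rcomplex R) _) _.
by rewrite /= !expr0n /= addr0 add0r !sqrtr_sqr.
Qed.

Lemma rv_norm u : AE x : R, `|rv u x| <= Linf_norm u.
Proof.
apply: filterS ((Linf_norm_le u _).1 (lexx _)) => x; apply: le_trans.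
exact: normc_Re.
Qed.

Lemma iv_norm u : AE x : R, `|iv u x| <= Linf_norm u.
Proof.
apply: filterS ((Linf_norm_le u _).1 (lexx _)) => x; apply: le_trans.
exact: normc_Im.
Qed.

Lemma I01_itv (t : I01 R) : 0 <= val t <= 1.
Proof. by case: t => t /= ; rewrite inE /= in_itv. Qed.

Lemma Iprim_subproof c u :
  (fun t : I01 R => c + Cintegral_from0 (val t) (repr u)) \in @Lip_fun R.
Proof.
apply/asboolP; exists (Linf_norm u + Linf_norm u) => s t.
have Hs := I01_itv s; have Ht := I01_itv t.
rewrite opprD addrACA subrr add0r; apply: le_trans (normc_le_ReIm _) _.
rewrite mulrDl lerD//.
  exact: (prim_lipschitz _ _ (measurable_rv u) (rv_norm u)).
exact: (prim_lipschitz _ _ (measurable_iv u) (iv_norm u)).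
Qed.

(** The Lipschitz function with value c at 0 and derivative u. *)
Definition Iprim c u : Lip R := MkLip (Iprim_subproof c u).

Lemma valL_I01 f (t : I01 R) : 'valL_ 0 f (val t) = f t.
Proof. exact: (congr1 (fun h => h t) (valLK 0 f)). Qed.

(** A real number of [0,1] as an element of the subtype. *)
Definition mkI01 (y : R) (y01 : 0 <= y <= 1) : I01 R :=
  exist _ y (mem_set (y01 : [set` `[0, 1]] y)).

Lemma Iprim_at0 c u : Iprim c u (I01_0 R) = c.
Proof.
rewrite /Iprim /= /Cintegral_from0 /= set_itv1 !Rintegral_set1.
by apply: complex_eq => /=; rewrite ?ReD ?ImD /= ?addr0.
Qed.

Lemma Iprim_has_derivative c u : AE x : R, has_derivative (Iprim c u) x (repr u x).
Proof.
apply: filterS2 (prim_derive _ _ (measurable_rv u) (rv_norm u)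
    (fun y => complex.Re ('valL_ 0 (Iprim c u) y)) (complex.Re c) _)
  (prim_derive _ _ (measurable_iv u) (iv_norm u)
    (fun y => complex.Im ('valL_ 0 (Iprim c u) y)) (complex.Im c) _).
- by [].
- move=> y y01; have := valL_I01 (Iprim c u) (mkI01 y y01) => /= ->.
  by rewrite ReD.
- move=> y y01; have := valL_I01 (Iprim c u) (mkI01 y y01) => /= ->.
  by rewrite ImD.
Qed.

Lemma has_derivative_uniq f x z z' : has_derivative f x z -> has_derivative f x z' -> z = z'.
Proof.
move=> [r i] [r' i']; apply: complex_eq.
  by rewrite -(derive_val (is_derive := r)) -(derive_val (is_derive := r')).
by rewrite -(derive_val (is_derive := i)) -(derive_val (is_derive := i')).
Qed.

Lemma Lip_deriv_uniq f u : (AE x : R, has_derivative f x (repr u x)) -> Lip_deriv f = u.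
Proof.
move=> H.
have K := @xgetPex _ (0 : L) [set u : L | {ae leb01 R, forall x, has_derivative f x (repr u x)}]
  (ex_intro _ u H).
apply/Linf_eqP; apply: filterS2 K H => x; exact: has_derivative_uniq.
Qed.

Lemma Lip_deriv_Iprim c u : Lip_deriv (Iprim c u) = u.
Proof. exact/Lip_deriv_uniq/Iprim_has_derivative. Qed.

Lemma clamp01 (x : R) : 0 <= Num.max 0 (Num.min x 1) <= 1.
Proof. by rewrite le_max lexx /= ge_max ler01 ge_min lexx orbT. Qed.

Lemma clamp_lip (x y : R) :
  `|Num.max 0 (Num.min x 1) - Num.max 0 (Num.min y 1)| <= `|x - y|.
Proof.
have E (a : R) : Num.max 0 (Num.min a 1) = if a < 0 then 0 else if a < 1 then a else 1.
  case: ifPn => [a0|]; first by rewrite min_l ?max_l// ltW// (lt_trans a0).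
  rewrite -leNgt => a0; case: ifPn => [a1|]; first by rewrite (min_l (ltW a1)) max_r.
  by rewrite -leNgt => a1; rewrite min_r// max_r.
have N (a b c d : R) : a <= b -> a - b <= c - d <= 0 -> `|c - d| <= `|a - b|.
  by move=> ab cd; rewrite !ler0_norm; lra.
wlog xy : x y / x <= y.
  move=> H; have [|yx] := leP x y; first exact: H.
  by rewrite distrC (distrC x); apply: H; exact: ltW.
apply: N => //; rewrite !E.
by case: (ltrP x 0) => ?; case: (ltrP y 0) => ?; try case: (ltrP x 1) => ?; try case: (ltrP y 1) => ?; lra.
Qed.

(** Each of the two parts of f is extended to the line by f(clamp x), to which the
    existence of a density applies. *)
Lemma Lip_primitive f : exists u, f = Iprim (f (I01_0 R)) u.
Proof.
have /asboolP[K HK] := Lip_valP f.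
pose M := Num.max K 1.
have M0 : 0 < M by rewrite lt_max ltr01 orbT.
have HM x y : Normc.normc (f x - f y) <= M * `|val x - val y|.
  by apply: le_trans (HK x y) _; rewrite ler_wpM2r// le_max lexx.
(* Projection of the real line onto [0,1]. *)
pose cl (x : R) := mkI01 _ (clamp01 x).
have cl_id (t : I01 R) : cl (val t) = t.
  apply: val_inj => /=; have /andP[t0 t1] := I01_itv t.
  by rewrite min_l// max_r.
have HR x y : `|complex.Re (f (cl x)) - complex.Re (f (cl y))| <= M * `|x - y|.
  rewrite -ReN -ReD; apply: le_trans (normc_Re _) _.
  apply: le_trans (HM _ _) _; rewrite ler_wpM2l ?(ltW M0)//.
  exact: clamp_lip.
have HI x y : `|complex.Im (f (cl x)) - complex.Im (f (cl y))| <= M * `|x - y|.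
  rewrite -ImN -ImD; apply: le_trans (normc_Im _) _.
  apply: le_trans (HM _ _) _; rewrite ler_wpM2l ?(ltW M0)//.
  exact: clamp_lip.
have [g [mg gM gE]] := lipschitz_density _ _ M0 HR.
have [h [mh hM hE]] := lipschitz_density _ _ M0 HI.
have [||||u Hu] := @Linf_exists R g h M.
- exact: measurable_funTS.
- exact: measurable_funTS.
- exact: aeW.
- exact: aeW.
have int_eq (p q : R -> R) (t : I01 R) : measurable_fun `[(0:R), 1] p -> measurable_fun `[(0:R), 1] q ->
    (AE x : R, p x = q x) ->
    \int[leb]_(x in `[0, val t]) p x = \int[leb]_(x in `[0, val t]) q x.
  move=> mp mq pq; have /andP[t0 t1] := I01_itv t.
  have sub : `[0, val t] `<=` `[(0:R), 1].
    by move=> x /=; rewrite !in_itv /= => /andP[-> xt]; rewrite (le_trans xt).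
  congr fine; apply: ae_eq_integral => //.
  - by apply/measurable_EFinP; exact: measurable_funS mp.
  - by apply/measurable_EFinP; exact: measurable_funS mq.
  - move/leb01_aeP : pq; apply: filterS => x pq /sub /=; rewrite in_itv /= => x01.
    by rewrite pq.
have cl0 : cl 0 = I01_0 R by apply: val_inj => /=; rewrite min_l// maxxx.
exists u; apply: val_inj; apply/funext => t /=.
have Er : \int[leb]_(x in `[0, val t]) rv u x = \int[leb]_(x in `[0, val t]) g x.
  apply: int_eq; [exact: measurable_rv|exact: measurable_funTS|].
  by apply: filterS Hu => x; rewrite /rv => ->.
have Ei : \int[leb]_(x in `[0, val t]) iv u x = \int[leb]_(x in `[0, val t]) h x.
  apply: int_eq; [exact: measurable_iv|exact: measurable_funTS|].
  by apply: filterS Hu => x; rewrite /iv => ->.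
have := gE _ (I01_itv t); rewrite -Er cl_id cl0 => HRe.
have := hE _ (I01_itv t); rewrite -Ei cl_id cl0 => HIm.
rewrite /Cintegral_from0; apply: complex_eq; rewrite ?ReD ?ImD /=.
  by rewrite -[X in _ + X]HRe addrC subrK.
by rewrite -[X in _ + X]HIm addrC subrK.
Qed.

Lemma Lip_eq_Iprim f : f = Iprim (f (I01_0 R)) (Lip_deriv f).
Proof.
have [u E] := Lip_primitive f.
by have -> : Lip_deriv f = u; [rewrite E Lip_deriv_Iprim|exact: E].
Qed.

Lemma Lip_eqP f g : f (I01_0 R) = g (I01_0 R) -> Lip_deriv f = Lip_deriv g -> f = g.
Proof. by move=> E0 E1; rewrite (Lip_eq_Iprim f) (Lip_eq_Iprim g) E0 E1. Qed.

Lemma Lip_has_derivative f : AE x : R, has_derivative f x (repr (Lip_deriv f) x).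
Proof.
apply: filterS (Iprim_has_derivative (f (I01_0 R)) (Lip_deriv f)) => x.
by rewrite -Lip_eq_Iprim.
Qed.

Lemma Lip_deriv_linear : linear (@Lip_deriv R : Lip R -> L).
Proof.
move=> z f g; apply: Lip_deriv_uniq.
apply: filterS4 (Lip_has_derivative f) (Lip_has_derivative g)
  (Linf_reprD (z *: Lip_deriv f) (Lip_deriv g)) (Linf_reprZ z (Lip_deriv f)).
move=> x [fr fi] [gr gi] -> ->.
have val_lin y : 'valL_ 0 (z *: f + g) y = z * 'valL_ 0 f y + 'valL_ 0 g y.
  rewrite /valL_ /=; case: ('oinv_set_val y) => [t|] /=; first by [].
  by rewrite mulr0 addr0.
split.
  have -> : (fun y => complex.Re ('valL_ 0 (z *: f + g) y)) =
      (complex.Re z \*: (fun y => complex.Re ('valL_ 0 f y)) -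
       complex.Im z \*: (fun y => complex.Im ('valL_ 0 f y)) +
       (fun y => complex.Re ('valL_ 0 g y)))%R.
    by apply/funext => y; rewrite val_lin ReD ReM.
  rewrite ReD ReM.
  by apply: is_deriveD; apply: is_deriveB; exact: is_deriveZ.
have -> : (fun y => complex.Im ('valL_ 0 (z *: f + g) y)) =
      (complex.Re z \*: (fun y => complex.Im ('valL_ 0 f y)) +
       complex.Im z \*: (fun y => complex.Re ('valL_ 0 f y)) +
       (fun y => complex.Im ('valL_ 0 g y)))%R.
  by apply/funext => y; rewrite val_lin ImD ImM.
rewrite ImD ImM.
by apply: is_deriveD; apply: is_deriveD; exact: is_deriveZ.
Qed.
End LipPrimitive.

(** * Splitting idempotents *)

Section IdempotentSplitting.
Context {R : realType}.
Local Notation leb := (@lebesgue_measure R).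
Local Notation L := (Linf R).
Implicit Types (u v e : L).

Lemma idem_norm e : idem e -> e <> 0 -> Linf_norm e = 1.
Proof.
move=> ie e0; apply/eqP; rewrite eq_le (pos_ball_norm _ (idem_pos_ball _ ie)) /= leNgt.
apply/negP => e1; apply: e0.
apply/(rv_eqP _ _ (pos_ball_ge0 _ (idem_pos_ball _ ie)) Linf0_ge0).
have H := (ge0_norm_leP _ _ (pos_ball_ge0 _ (idem_pos_ball _ ie))).1 (lexx (Linf_norm e)).
apply: filterS3 H ie rv0 => x H [_ [-> ->//|ex] _].
by move: H; rewrite ex leNgt e1.
Qed.

Lemma Rintegral_ae0 (v : R -> R) (A : set (measurableTypeR R)) :
  measurable A -> measurable_fun A v -> {ae leb, forall x : R, A x -> v x = 0} ->
  \int[leb]_(x in A) v x = 0.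
Proof.
move=> mA mv H; rewrite /Rintegral (@ae_eq_integral _ _ _ _ _ (cst 0%E)) ?integral0//.
  exact/measurable_EFinP.
by apply: filterS H => x H Ax; rewrite H.
Qed.

(** The measure has no atoms: inside the set where u exceeds half its norm there are
    two disjoint nonzero idempotents. The set is cut at a point where its
    distribution function takes half its final value. *)
Lemma idem_split u : Linf_ge0 u -> u <> 0 -> exists e f,
  [/\ idem e, idem f, e <> 0, f <> 0 &
   AE x : R, (rv e x = 0 \/ rv f x = 0) /\
     (rv e x = 1 \/ rv f x = 1 -> Linf_norm u / 2 < rv u x)].
Proof.
move=> u_ge0 u0; pose s := Linf_norm u.
have s0 : 0 < s.
  by rewrite lt_neqAle Linf_norm_ge0 andbT eq_sym; apply/eqP => /Linf_norm0_eq.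
pose b (x : R) := s / 2 < rv u x.
have mb : measurable_fun `[(0:R), 1] b.
  by apply: measurable_fun_ltr; [exact: measurable_cst|exact: measurable_rv].
pose v (x : R) : R := if b x then 1 else 0.
have mv : measurable_fun `[(0:R), 1] v.
  by apply: measurable_fun_if => //; exact: measurable_cst.
have v1 (x : R) : `|v x| <= 1 by rewrite /v; case: (b x); rewrite ?normr0 ?normr1.
have Iv : leb.-integrable `[(0:R), 1] (EFin \o v) by exact: bounded_integrable_itv v1.
pose F (t : R) := \int[leb]_(x in `[0, t]) v x.
have F0 : F 0 = 0 by rewrite /F set_itv1 Rintegral_set1.
have F1 : 0 < F 1.
  rewrite lt_neqAle Rintegral_ge0 ?andbT; last by move=> x _; rewrite /v; case: (b x).
  apply/eqP => F1.
  have mJ : measurable (`[(0:R), 1]%classic : set (measurableTypeR R)) by exact: measurable_itv.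
  have mEv : measurable_fun (`[(0:R), 1]%classic : set (measurableTypeR R)) (EFin \o v) by exact/measurable_EFinP.
  have I0 : (\int[leb]_(x in `[0%R, 1%R]) `|(EFin \o v) x| = 0)%E.
    have -> : (\int[leb]_(x in `[0%R, 1%R]) `|(EFin \o v) x| = \int[leb]_(x in `[0%R, 1%R]) (EFin \o v) x)%E.
      by apply: eq_integral => x _ /=; rewrite /v; case: (b x); rewrite ?normr0 ?normr1.
    rewrite -[LHS]fineK ?(integrable_fin_num _ Iv)//.
    by move: F1; rewrite /F /Rintegral => <-.
  have H := (@ae_eq_integral_abs _ _ R leb _ mJ _ mEv).1 I0.
  have : s <= s / 2.
    apply/(ge0_norm_leP _ _ u_ge0); apply/leb01_aeP; apply: filterS H => x H x01.
    have : v x = 0 by have := H ltac:(by rewrite /= in_itv); case.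
    by rewrite /v /b; case: ltrP => // _ /eqP; rewrite oner_eq0.
  by rewrite leNgt ltr_pdivrMr// mulr_natr mulr2n ltrDl s0.
have [t t01 Ft] : exists2 t : R, t \in `[0, 1] & F t = F 1 / 2.
  apply: IVT; first exact: ler01.
    by apply: parameterized_integral_continuous => //; exact: ler01.
  rewrite F0 min_l ?max_r ?(ltW F1)//; apply/andP; split; first by rewrite divr_ge0 ?ltW.
  by rewrite ler_pdivrMr// mulr_natr mulr2n lerDl ltW.
rewrite in_itv /= in t01; have /andP[t0 t1] := t01.
have [|e ie Ee] := idem_exists (fun x => b x && (x <= t)).
  by apply: measurable_and => //; apply: measurable_fun_ler => //; exact: measurable_cst.
have [|f jf Ef] := idem_exists (fun x => b x && (t < x)).
  by apply: measurable_and => //; apply: measurable_fun_ltr => //; exact: measurable_cst.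
have Ft0 : F t <> 0 by apply/eqP; rewrite Ft gt_eqF// divr_gt0.
exists e, f; split => //.
- move=> e0; apply: Ft0; apply: Rintegral_ae0 => //.
    apply: measurable_funS mv => // x /=.
    by rewrite !in_itv /= => /andP[-> xt]; rewrite (le_trans xt).
  have K : AE x : R, (if b x && (x <= t) then 1 else 0 : R) = 0.
    by apply: filterS2 Ee rv0 => x; rewrite e0 => ->.
  apply: filterS ((leb01_aeP _).1 K) => x H; rewrite /= in_itv /= => /andP[x0 xt].
  have x01 : 0 <= x <= 1 by rewrite x0 (le_trans xt).
  by have := H x01; rewrite xt andbT.
- move=> f0.
  have : F 1 - F t = 0.
    rewrite /F Rintegral_itvB//.
    apply: Rintegral_ae0 => //.
      apply: measurable_funS mv => // x /=.
      by rewrite !in_itv /= => /andP[xt ->]; rewrite andbT (le_trans t0)// ltW.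
    have K : AE x : R, (if b x && (t < x) then 1 else 0 : R) = 0.
      by apply: filterS2 Ef rv0 => x; rewrite f0 => ->.
    apply: filterS ((leb01_aeP _).1 K) => x H; rewrite /= in_itv /= => /andP[xt x1].
    have x01 : 0 <= x <= 1 by rewrite x1 andbT (le_trans t0)// ltW.
    by have := H x01; rewrite xt andbT.
  move/eqP; rewrite subr_eq0 Ft => /eqP E.
  by move: (F 1) E F1 => y E F1; clear - E F1; lra.
- apply: filterS2 Ee Ef => x -> ->; rewrite /b.
  case: (ltrP (s / 2) (rv u x)) => //= bx; last first.
    by split; [left|move=> [] /esym/eqP; rewrite oner_eq0].
  by split=> //; case: ltrP; [left|right].
Qed.
End IdempotentSplitting.

(** * Coordinates on the positive unit sphere *)

Section SphereCoordinates.
Context {R : realType} (p : \bar R).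
Local Notation leb := (@lebesgue_measure R).
Local Notation L := (Linf R).
Local Notation S := (pos_sphere p).
Implicit Types (u v : L) (x y : S).

(** The norm of R^2 that defines the norm of Lip[0,1] from |f(0)| and |f'|. *)
Definition pair_norm (a b : R) : R :=
  match p with
  | r%:E => (a `^ r + b `^ r) `^ r^-1
  | +oo%E => Num.max a b
  | -oo%E => 0
  end.

Lemma sigma_normE f :
  sigma_norm p f = pair_norm (Normc.normc (f (I01_0 R))) (Linf_norm (Lip_deriv f)).
Proof. by []. Qed.

(** First coordinate f(0) of a point of the sphere. *)
Definition start x : R := complex.Re (val x (I01_0 R)).
(** Second coordinate f' of a point of the sphere. *)
Definition slope x : L := Lip_deriv (val x).

Lemma Lip_deriv0 : Lip_deriv (0 : Lip R) = 0 :> L.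
Proof.
have := Lip_deriv_linear (-1) (0 : Lip R) 0.
by rewrite scaleN1r oppr0 addr0 => ->; rewrite scaleN1r addNr.
Qed.

Lemma Lip_derivB f g : Lip_deriv (f - g) = Lip_deriv f - Lip_deriv g :> L.
Proof.
have := Lip_deriv_linear (-1) g f.
by rewrite !scaleN1r => E; rewrite addrC E addrC.
Qed.

Lemma Linf_leP u : Linf_le 0 u <-> Linf_ge0 u.
Proof.
split=> H; apply: filterS2 H Linf_repr0 => x; rewrite /iv /rv.
  by move=> xu x0; move: xu; rewrite x0 lecE /= => /andP[/eqP].
by move=> [i u0] ->; rewrite lecE /= i u0 eqxx.
Qed.

Lemma sphereP x : [/\ 0 <= start x, val x (I01_0 R) = (start x)%:C, Linf_ge0 (slope x)
  & pair_norm (start x) (Linf_norm (slope x)) = 1].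
Proof.
have /set_mem[re nx [x0 x1]] := valP x.
have E0 : val x (I01_0 R) = (start x)%:C by apply: complex_eq => //=; rewrite re.
have h0 : 0 <= start x by move: x0; rewrite lecE /= => /andP[_].
split => //.
  by apply/Linf_leP; rewrite -Lip_deriv0.
by move: nx; rewrite sigma_normE E0 normc_real//= ger0_norm.
Qed.

Lemma sphere_exists a u : 0 <= a -> Linf_ge0 u -> pair_norm a (Linf_norm u) = 1 ->
  exists x, start x = a /\ slope x = u.
Proof.
move=> a0 u0 N1; pose f := Iprim a%:C u.
have Sf : f \in pos_sphere p.
  apply/mem_set; split.
  - move=> t; transitivity (complex.Im (a%:C + Cintegral_from0 (val t) (repr u))) => //.
    rewrite ImD /= add0r.
    have /andP[t0 t1] := I01_itv t.
    apply: Rintegral_ae0 => //.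
      apply: measurable_funS (measurable_iv u) => // y /=.
      by rewrite !in_itv /= => /andP[-> yt]; rewrite (le_trans yt).
    apply: filterS ((leb01_aeP _).1 u0) => y H; rewrite /= in_itv /= => /andP[y0 yt].
    have y01 : 0 <= y <= 1 by rewrite y0 (le_trans yt).
    by have [] := H y01.
  - by rewrite sigma_normE Iprim_at0 Lip_deriv_Iprim normc_real//= ger0_norm.
  - split; first by rewrite Iprim_at0 lecE /= eqxx.
    by rewrite Lip_deriv0 Lip_deriv_Iprim; apply/Linf_leP.
exists (exist _ f Sf); split; last exact: Lip_deriv_Iprim.
by transitivity (complex.Re (f (I01_0 R))) => //; rewrite Iprim_at0.
Qed.

Lemma sphere_dist x y :
  sigma_norm p (val x - val y) = pair_norm `|start x - start y| (Linf_norm (slope x - slope y)).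
Proof.
rewrite sigma_normE Lip_derivB; congr pair_norm.
have [_ Ex _ _] := sphereP x; have [_ Ey _ _] := sphereP y.
have -> : (val x - val y) (I01_0 R) = val x (I01_0 R) - val y (I01_0 R) by [].
by rewrite Ex Ey normc_real ?ReD ?ImD ?ReN ?ImN //= subrr.
Qed.

Lemma sphere_eq x y : start x = start y -> slope x = slope y -> x = y.
Proof.
move=> Eh Et; apply: val_inj; apply: Lip_eqP => //.
have [_ -> _ _] := sphereP x; have [_ -> _ _] := sphereP y.
by rewrite Eh.
Qed.
End SphereCoordinates.

(** * The positive unit sphere for finite exponents *)

Lemma pos_ball_dist1 {R : realType} (u v : Linf R) : pos_ball u -> pos_ball v -> Linf_norm (u - v) <= 1.
Proof.
move=> Hu Hv; apply/(pos_ball_distP _ _ _ Hu Hv).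
apply: filterS2 Hu Hv => x [_ /andP[? ?]] [_ /andP[? ?]].
by rewrite ler_norml; apply/andP; split; lra.
Qed.

Lemma exists_two_units {R : realType} : exists u v : Linf R,
  [/\ pos_ball u, pos_ball v, Linf_norm u = 1, Linf_norm v = 1 & u <> v].
Proof.
have one0 : (1 : Linf R) <> 0 by apply/eqP; rewrite oner_eq0.
have [e [f [ie jf e0 f0 ef]]] := idem_split (1 : Linf R) (pos_ball_ge0 _ pos_ball1) one0.
exists e, f; split; [exact: idem_pos_ball|exact: idem_pos_ball|exact: idem_norm|exact: idem_norm|].
move=> E; apply: e0; apply/(rv_eqP _ _ (pos_ball_ge0 _ (idem_pos_ball _ ie)) Linf0_ge0).
apply: filterS2 ef rv0 => x [+ _] ->; rewrite -E.
by case.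
Qed.

Section FiniteExponent.
Context {R : realType} (r : R) (r1 : 1 <= r).
Local Notation L := (Linf R).
Local Notation S := (pos_sphere r%:E).
Variable Delta : S -> S.
Hypothesis Dsurj : forall y : S, exists x : S, Delta x = y.
Hypothesis Disom : forall x y : S,
  sigma_norm r%:E (val (Delta x) - val (Delta y)) = sigma_norm r%:E (val x - val y).
Implicit Types (u v : L) (x y : S) (a b : R).

Let r0 : 0 < r. Proof. exact: lt_le_trans r1. Qed.
Let rn0 : r != 0. Proof. by rewrite gt_eqF. Qed.

Let pw_inj a b : 0 <= a -> 0 <= b -> a `^ r = b `^ r -> a = b.
Proof. by move=> a0 b0; apply: powR_injective => //; rewrite nnegrE. Qed.
Let pw_le a b : 0 <= a -> a <= b -> a `^ r <= b `^ r.
Proof.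
move=> a0 ab; apply: ge0_ler_powR => //; rewrite ?nnegrE ?(ltW r0)//.
exact: le_trans ab.
Qed.
Let pw_lt a b : 0 <= a -> a < b -> a `^ r < b `^ r.
Proof.
move=> a0 ab; apply: gt0_ltr_powR => //; rewrite ?nnegrE //.
by apply: ltW; exact: le_lt_trans ab.
Qed.
Let pw1 : 1 `^ r = 1 :> R. Proof. by rewrite powR1. Qed.
Let pw0 : 0 `^ r = 0 :> R. Proof. by rewrite powR0. Qed.

Let pair_normE a b : (pair_norm r%:E a b) `^ r = a `^ r + b `^ r.
Proof. by rewrite /pair_norm -powRrM mulVf// powRr1// addr_ge0 ?powR_ge0. Qed.

Let pair_norm1 a b : pair_norm r%:E a b = 1 <-> a `^ r + b `^ r = 1.
Proof.
split=> [E|E]; first by rewrite -pair_normE E.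
by rewrite /pair_norm E powR1.
Qed.

(** The r-th power of the distance. *)
Let D x y := `|start _ x - start _ y| `^ r + Linf_norm (slope _ x - slope _ y) `^ r.

Let D_pres x y : D (Delta x) (Delta y) = D x y.
Proof. by have := Disom x y; rewrite !sphere_dist /D -!pair_normE => ->. Qed.

Let sph x : start _ x `^ r + Linf_norm (slope _ x) `^ r = 1.
Proof. by apply/pair_norm1; have [] := sphereP _ x. Qed.

Let start0 x : 0 <= start _ x. Proof. by have [] := sphereP _ x. Qed.
Let start1 x : start _ x <= 1.
Proof.
rewrite leNgt; apply/negP => h; have := pw_lt _ _ ler01 h.
by rewrite pw1 -{1}(sph x) ltNge lerDl powR_ge0.
Qed.
Let slopeB x : pos_ball (slope _ x).
Proof.
have [_ _ t0 _] := sphereP _ x; apply: pos_ballP => //.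
rewrite leNgt; apply/negP => h; have := pw_lt _ _ ler01 h.
by rewrite pw1 -{1}(sph x) ltNge lerDr powR_ge0.
Qed.

Let slope_inj x y : slope _ x = slope _ y -> x = y.
Proof.
move=> E; apply: sphere_eq => //; apply: pw_inj => //.
by apply: (addIr (Linf_norm (slope _ x) `^ r)); rewrite {2}E !sph.
Qed.

Let slope_surj u : pos_ball u -> exists x, slope _ x = u.
Proof.
move=> Hu; have n1 : Linf_norm u `^ r <= 1.
  by rewrite -[leRHS]pw1; apply: pw_le; [exact: Linf_norm_ge0|exact: pos_ball_norm].
have s0 : 0 <= 1 - Linf_norm u `^ r by rewrite subr_ge0.
have [|x [_ E]] := sphere_exists r%:E ((1 - Linf_norm u `^ r) `^ r^-1) u (powR_ge0 _ _) (pos_ball_ge0 _ Hu).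
  by apply/pair_norm1; rewrite -powRrM mulVf// powRr1// subrK.
by exists x.
Qed.

(** The point (1, 0). *)
Let x1 : {x : S | slope _ x = 0}. Proof. by apply: cid; apply: slope_surj; exact: pos_ball0. Qed.

Let start_x1 : start _ (sval x1) = 1.
Proof.
apply: pw_inj => //; have := sph (sval x1).
by rewrite (svalP x1) Linf_norm0 pw0 addr0 pw1.
Qed.

Let start1_x1 x : start _ x = 1 -> x = sval x1.
Proof.
move=> h; apply: slope_inj; rewrite (svalP x1); apply: Linf_norm0_eq.
apply: (powR_eq0_eq0 (p := r)).
by have := sph x; rewrite h pw1 => /eqP; rewrite addrC -subr_eq0 addrK => /eqP.
Qed.

Let D_x1 x : D x (sval x1) = (1 - start _ x) `^ r + Linf_norm (slope _ x) `^ r.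
Proof.
by rewrite /D start_x1 (svalP x1) subr0 distrC ger0_norm// subr_ge0.
Qed.

(** The point (1, 0) belongs to every pair at the maximal distance 2^(1/r). *)
Let diam x y : D x y = 2 -> x = sval x1 \/ y = sval x1.
Proof.
move=> D2.
have n1 : Linf_norm (slope _ x - slope _ y) `^ r <= 1.
  by rewrite -[leRHS]pw1; apply: pw_le; [exact: Linf_norm_ge0|exact: pos_ball_dist1].
have h1 : 1 <= `|start _ x - start _ y| `^ r.
  by move: D2 n1; rewrite /D; move: (_ `^ r) (_ `^ r) => s t; lra.
have {}h1 : 1 <= `|start _ x - start _ y|.
  rewrite leNgt; apply/negP => /(pw_lt _ _ (normr_ge0 _)).
  by rewrite pw1 ltNge h1.
have := start0 x; have := start0 y; have := start1 x; have := start1 y.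
move: h1; rewrite ler_normr => /orP[] h ? ? ? ?; [left|right]; apply: start1_x1; lra.
Qed.

Let fix_x1 : Delta (sval x1) = sval x1.
Proof.
apply: contrapT => nx1.
have [u [v [Hu Hv nu nv uv]]] := @exists_two_units R.
have [y Ey] := slope_surj u Hu; have [z Ez] := slope_surj v Hv.
have K w : Linf_norm (slope _ w) = 1 -> Delta w = sval x1.
  move=> nw.
  have hw : start _ w = 0.
    apply: pw_inj => //; have := sph w; rewrite nw pw1 pw0 => /eqP.
    by rewrite -subr_eq0 addrK => /eqP.
  have : D (Delta w) (Delta (sval x1)) = 2.
    by rewrite D_pres D_x1 nw hw subr0 pw1.
  by move=> /diam[].
apply: uv; rewrite -Ey -Ez; congr (slope _ _); apply: slope_inj.
apply/eqP; rewrite -subr_eq0; apply/eqP/Linf_norm0_eq.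
have : D y z = 0.
  by rewrite -D_pres !K ?Ey ?Ez// /D !subrr normr0 Linf_norm0 pw0 addr0.
move=> /eqP; rewrite /D paddr_eq0 ?powR_ge0// => /andP[_ /eqP].
exact: powR_eq0_eq0.
Qed.

Let start_pres x : start _ (Delta x) = start _ x.
Proof.
have E : (1 - start _ (Delta x)) `^ r - start _ (Delta x) `^ r = (1 - start _ x) `^ r - start _ x `^ r.
  have := D_pres x (sval x1); rewrite fix_x1 !D_x1.
  have := sph x; have := sph (Delta x).
  by do 6 move: (_ `^ r) => ?; lra.
have mono a b : 0 <= a -> b <= 1 -> a < b ->
    (1 - b) `^ r - b `^ r < (1 - a) `^ r - a `^ r.
  move=> a0 b1 ab; have := pw_lt _ _ a0 ab.
  have : (1 - b) `^ r <= (1 - a) `^ r by apply: pw_le; rewrite ?subr_ge0// lerD2l lerN2 ltW.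
  by do 4 move: (_ `^ r) => ?; lra.
apply/eqP; rewrite eq_le !leNgt; apply/andP; split; apply/negP => /mono K.
  by have := K (start0 _) (start1 _); rewrite E ltxx.
by have := K (start0 _) (start1 _); rewrite E ltxx.
Qed.

Let slope_dist x y : Linf_norm (slope _ (Delta x) - slope _ (Delta y)) = Linf_norm (slope _ x - slope _ y).
Proof.
apply: pw_inj; [exact: Linf_norm_ge0..|].
by have := D_pres x y; rewrite /D !start_pres => /addrI.
Qed.

(** The map Phi is read on the second coordinates, which determine the point. *)
Lemma finite_sphere_reduction : exists2 Phi : L -> L, ball_isometry Phi & forall x,
  [/\ start _ (Delta x) = start _ x, slope _ (Delta x) = Phi (slope _ x) & pos_ball (slope _ x)].
Proof.
pose Phi u := xget 0 [set w | exists2 x, slope _ x = u & w = slope _ (Delta x)].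
have PhiE x : Phi (slope _ x) = slope _ (Delta x).
  have [y E Ew] := @xgetPex _ 0 [set w | exists2 y, slope _ y = slope _ x & w = slope _ (Delta y)]
    (ex_intro _ _ (ex_intro2 _ _ x erefl erefl)).
  by rewrite /Phi Ew (slope_inj _ _ E).
exists Phi; last by move=> x; rewrite start_pres PhiE; split.
split.
- by move=> u /slope_surj[x <-]; rewrite PhiE.
- move=> v /slope_surj[y <-]; have [x <-] := Dsurj y.
  by exists (slope _ x); rewrite ?PhiE.
- by move=> u v /slope_surj[x <-] /slope_surj[y <-]; rewrite !PhiE slope_dist.
- by rewrite -{1}(svalP x1) PhiE fix_x1 (svalP x1).
Qed.
End FiniteExponent.

(** * The positive unit sphere for the infinite exponent *)

Section UnitSphereOrder.
Context {R : realType}.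
Local Notation L := (Linf R).
Implicit Types (u v w : L).

(** If v has norm 1 and u >= v except where v is bounded away from 1, then u has
    norm 1 too. *)
Lemma norm_eq1_cut u v e : 0 < e -> pos_ball u -> pos_ball v -> Linf_norm v = 1 ->
  (AE x : R, rv v x <= rv u x \/ rv v x <= 1 - e) -> Linf_norm u = 1.
Proof.
move=> e0 Hu Hv nv H; apply/eqP; rewrite eq_le (pos_ball_norm _ Hu) /= leNgt.
apply/negP => u1.
have : Linf_norm v <= Num.max (Linf_norm u) (1 - e).
  apply/(ge0_norm_leP _ _ (pos_ball_ge0 _ Hv)).
  apply: filterS2 H ((ge0_norm_leP _ _ (pos_ball_ge0 _ Hu)).1 (lexx _)) => x [] vx ux.
    by rewrite le_max (le_trans vx ux).
  by rewrite le_max vx orbT.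
rewrite nv leNgt gt_max u1 /=.
by rewrite ltrBlDr ltrDl e0.
Qed.

(** A version of the metric description of the order that uses only elements of
    norm 1. *)
Lemma ae_le_unit_dist u v : pos_ball u -> pos_ball v -> Linf_norm u = 1 -> Linf_norm v = 1 ->
  (forall w, pos_ball w -> Linf_norm w = 1 ->
     Linf_norm (u - w) <= 2^-1 <-> Linf_norm (v - w) <= 2^-1) -> ae_le u v.
Proof.
move=> Hu Hv nu nv H.
have mu := measurable_rv u; have mv := measurable_rv v.
have B01 : AE x : R, 0 <= rv u x <= 1 /\ 0 <= rv v x <= 1.
  by apply: filterS2 Hu Hv => x [_ ?] [_ ?].
(* If u exceeds max(v, 1/2) by e on the set b, replacing v by max(v - 1/2, 0) there gives w at
   distance at most 1/2 from v but not from u; outside b, w agrees with v, so it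
   still has norm 1. *)
have K1 e : 0 < e -> AE x : R, ~~ ((rv v x + e <= rv u x) && (2^-1 + e <= rv u x)).
  move=> e0; pose b x := (rv v x + e <= rv u x) && (2^-1 + e <= rv u x).
  have mb : measurable_fun `[(0:R), 1] b.
    apply: measurable_and; apply: measurable_fun_ler => //; try exact: measurable_cst.
    by apply: measurable_funD => //; exact: measurable_cst.
  have [||w Hw Ew] := @pos_ball_exists R (fun x => if b x then Num.max (rv v x - 2^-1) 0 else rv v x).
  - apply: measurable_fun_if => //; last exact: measurable_funS mv.
    apply: (@measurable_funS _ _ _ _ `[(0:R), 1]) => //.
    apply: measurable_maxr; last exact: measurable_cst.
    by apply: measurable_funB => //; exact: measurable_cst.
  - apply: filterS B01 => x [/andP[? ?] /andP[? ?]].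
    by case: (b x); minmax; apply/andP; split; lra.
  have nw : Linf_norm w = 1.
    apply: (norm_eq1_cut w v e) => //.
    apply: filterS2 Ew B01 => x -> [/andP[? ?] /andP[? ?]].
    by case: ifPn; [move=> /andP[? ?]; right; lra|left].
  have : Linf_norm (u - w) <= 2^-1.
    apply: (H w Hw nw).2; apply/(pos_ball_distP _ _ _ Hv Hw); apply: filterS2 Ew B01.
    move=> x -> [/andP[? ?] /andP[? ?]]; rewrite ler_norml.
    by case: (b x); minmax; apply/andP; split; lra.
  move=> /(pos_ball_distP _ _ _ Hu Hw) dw; apply: filterS3 dw Ew B01.
  move=> x + wx [/andP[? ?] /andP[? ?]]; rewrite wx -/(b x); case: (boolP (b x)) => //.
  by move=> /andP[? ?]; rewrite ler_norml; minmax => /andP[? ?]; lra.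
(* Dually, where v + e <= min(u, 1/2), replace u by min(u + 1/2, 1). *)
have K2 e : 0 < e -> AE x : R, ~~ ((rv v x + e <= rv u x) && (rv v x + e <= 2^-1)).
  move=> e0; pose b x := (rv v x + e <= rv u x) && (rv v x + e <= 2^-1).
  have mve : measurable_fun `[(0:R), 1] (fun x => rv v x + e).
    by apply: measurable_funD => //; exact: measurable_cst.
  have mb : measurable_fun `[(0:R), 1] b.
    by apply: measurable_and; apply: measurable_fun_ler => //; exact: measurable_cst.
  have [||w Hw Ew] := @pos_ball_exists R (fun x => if b x then Num.min (rv u x + 2^-1) 1 else rv u x).
  - apply: measurable_fun_if => //; last exact: measurable_funS mu.
    apply: (@measurable_funS _ _ _ _ `[(0:R), 1]) => //.
    apply: measurable_minr; last exact: measurable_cst.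
    by apply: measurable_funD => //; exact: measurable_cst.
  - apply: filterS B01 => x [/andP[? ?] /andP[? ?]].
    by case: (b x); minmax; apply/andP; split; lra.
  have nw : Linf_norm w = 1.
    apply: (norm_eq1_cut w u e) => //.
    apply: filterS2 Ew B01 => x -> [/andP[? ?] /andP[? ?]]; left.
    by case: (b x); minmax; lra.
  have : Linf_norm (v - w) <= 2^-1.
    apply: (H w Hw nw).1; apply/(pos_ball_distP _ _ _ Hu Hw); apply: filterS2 Ew B01.
    move=> x -> [/andP[? ?] /andP[? ?]]; rewrite ler_norml.
    by case: (b x); minmax; apply/andP; split; lra.
  move=> /(pos_ball_distP _ _ _ Hv Hw) dw; apply: filterS3 dw Ew B01.
  move=> x + wx [/andP[? ?] /andP[? ?]]; rewrite wx -/(b x); case: (boolP (b x)) => //.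
  by move=> /andP[? ?]; rewrite ler_norml; minmax => /andP[? ?]; lra.
have K : AE x : R, forall n : nat,
    ~~ ((rv v x + n.+1%:R^-1 <= rv u x) && (2^-1 + n.+1%:R^-1 <= rv u x)) /\
    ~~ ((rv v x + n.+1%:R^-1 <= rv u x) && (rv v x + n.+1%:R^-1 <= 2^-1)).
  apply: ae_foralln => n.
  have n0 : 0 < n.+1%:R^-1 :> R by rewrite invr_gt0 ltr0n.
  by apply: filterS2 (K1 _ n0) (K2 _ n0).
apply: filterS K => x K; rewrite leNgt; apply/negP => vu.
have [hv|hv] := leP 2^-1 (rv v x).
  have [n Hn] := ltr_add_invr vu; have [/negP N _] := K n; apply: N.
  by rewrite (ltW Hn) /= (le_trans _ (ltW Hn))// lerD2r.
have : rv v x < Num.min (rv u x) 2^-1 by rewrite lt_min vu.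
move=> /ltr_add_invr[n]; rewrite lt_min => /andP[h1 h2].
by have [_ /negP N] := K n; apply: N; rewrite !ltW.
Qed.

Lemma unit_dist_eq u v : pos_ball u -> pos_ball v -> Linf_norm u = 1 -> Linf_norm v = 1 ->
  (forall w, pos_ball w -> Linf_norm w = 1 ->
     Linf_norm (u - w) <= 2^-1 <-> Linf_norm (v - w) <= 2^-1) -> u = v.
Proof.
move=> Hu Hv nu nv H; apply: ae_le_anti => //; first exact: ae_le_unit_dist.
by apply: ae_le_unit_dist => // w Hw nw; rewrite H.
Qed.
End UnitSphereOrder.

Section RealInequalities.
Variable R : realFieldType.
Implicit Types s t a h e g : R.

Lemma half_dist_le s a : 0 < s -> s <= 1 -> 0 <= a -> a <= 1 ->
  `|2^-1 + 2^-1 * 0 - a| <= 1 - s / 2.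
Proof. by move=> ? ? ? ?; rewrite ler_norml; apply/andP; split; lra. Qed.

Lemma unit_dist_le s a : 0 < s -> s <= 1 -> s / 2 < a -> a <= 1 ->
  `|2^-1 + 2^-1 * 1 - a| <= 1 - s / 2.
Proof. by move=> ? ? ? ?; rewrite ler_norml; apply/andP; split; lra. Qed.

Lemma half_lt1 : 2^-1 < 1 :> R. Proof. lra. Qed.

Lemma onem_half_lt1 s : 0 < s -> 1 - s / 2 < 1. Proof. lra. Qed.

Lemma half_dist_lt1 h : 0 <= h -> h <= 1 -> `|2^-1 - h| < 1.
Proof. by move=> ? ?; rewrite ltr_norml; apply/andP; split; lra. Qed.

Lemma half_dist_half g : g = 0 \/ g = 1 -> `|2^-1 + 2^-1 * g - g| <= 2^-1.
Proof. by case=> ->; rewrite ler_norml; apply/andP; split; lra. Qed.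

Lemma mul_dist_le t e s : 1 - e <= t -> t <= 1 -> 0 < e -> 0 <= s -> s <= 1 ->
  `|s - t * s| <= e.
Proof. by move=> ? ? ? ? ?; rewrite ler_norml; apply/andP; split; nra. Qed.
End RealInequalities.

Section InfiniteExponent.
Context {R : realType}.
Local Notation L := (Linf R).
Local Notation S := (pos_sphere (+oo%E : \bar R)).
Local Notation start := (start (+oo%E : \bar R)).
Local Notation slope := (slope (+oo%E : \bar R)).
Implicit Types (u v w : L) (x y z n : S) (a b : R).

(** The distance for p = oo. *)
Let D x y : R := Num.max `|start x - start y| (Linf_norm (slope x - slope y)).

(** Surjective isometries of the sphere for p = oo. *)
Definition sup_sphere_isometry (Delta : S -> S) :=
  (forall y, exists x, Delta x = y) /\
  forall x y, sigma_norm +oo%E (val (Delta x) - val (Delta y)) = sigma_norm +oo%E (val x - val y).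

Let D_pres Delta x y : sup_sphere_isometry Delta -> D (Delta x) (Delta y) = D x y.
Proof. by move=> [_ H]; have := H x y; rewrite !sphere_dist. Qed.

Let sph x : Num.max (start x) (Linf_norm (slope x)) = 1.
Proof. by have [] := sphereP _ x. Qed.
Let start0 x : 0 <= start x. Proof. by have [] := sphereP _ x. Qed.
Let start1 x : start x <= 1. Proof. by rewrite -(sph x) le_max lexx. Qed.
Let slopeB x : pos_ball (slope x).
Proof.
have [_ _ t0 _] := sphereP _ x; apply: pos_ballP => //.
by rewrite -(sph x) le_max lexx orbT.
Qed.
Let sph_lt x : start x < 1 -> Linf_norm (slope x) = 1.
Proof.
move=> h; have := sph x; case: (leP (start x) (Linf_norm (slope x))) => // _ E.
by rewrite E ltxx in h.
Qed.
Let sph_lt' x : Linf_norm (slope x) < 1 -> start x = 1.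
Proof.
move=> h; have := sph x; case: (leP (start x) (Linf_norm (slope x))) => // _ E.
by rewrite E ltxx in h.
Qed.

Let sphere_start1 u : pos_ball u -> exists x, start x = 1 /\ slope x = u.
Proof.
move=> Hu; apply: sphere_exists => //; first exact: pos_ball_ge0.
by rewrite /pair_norm max_l//; exact: pos_ball_norm.
Qed.
Let sphere_norm1 a u : 0 <= a <= 1 -> pos_ball u -> Linf_norm u = 1 -> exists x, start x = a /\ slope x = u.
Proof.
move=> /andP[a0 a1] Hu nu; apply: sphere_exists => //; first exact: pos_ball_ge0.
by rewrite /pair_norm nu max_r.
Qed.

Let x1 : {x : S | start x = 1 /\ slope x = 0}.
Proof. by apply: cid; apply: sphere_start1; exact: pos_ball0. Qed.
Let start_x1 : start (sval x1) = 1. Proof. by case: (svalP x1). Qed.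
Let slope_x1 : slope (sval x1) = 0. Proof. by case: (svalP x1). Qed.

Let D_x1 x : D x (sval x1) = Num.max (1 - start x) (Linf_norm (slope x)).
Proof. by rewrite /D start_x1 slope_x1 subr0 distrC ger0_norm// subr_ge0. Qed.

Let D_eq0 x y : D x y = 0 -> x = y.
Proof.
move=> D0; have h : `|start x - start y| <= 0 by rewrite -D0 le_max lexx.
have t : Linf_norm (slope x - slope y) <= 0 by rewrite -D0 le_max lexx orbT.
apply: sphere_eq; apply/eqP; rewrite -subr_eq0.
  by rewrite -normr_le0.
by apply/eqP/Linf_norm0_eq/eqP; rewrite eq_le t Linf_norm_ge0.
Qed.

(** The open balls of radius 1 around x and y meet. *)
Let meet x y := exists n, D n x < 1 /\ D n y < 1.
(** This metric property singles out the point (1, 0). *)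
Let P x := forall y z, meet x y -> meet x z -> meet y z.

(** The ball around (1, 0) consists of the (1, u) with |u| < 1. A ball that meets it
    is centred at some (b, w) with b > 0, hence contains (1, 1/2). *)
Let P_x1 : P (sval x1).
Proof.
have h01 : 0 <= (2^-1 : R) <= 1 by lra.
have Hc := pos_ball_cst _ h01.
have [n [hn tn]] := sphere_start1 _ Hc.
have K y : meet (sval x1) y -> D n y < 1.
  move=> [m []]; rewrite D_x1 gt_max => /andP[_ tm]; rewrite /D !gt_max hn tn.
  rewrite (sph_lt' _ tm) => /andP[hy _].
  have y0 : 0 < start y.
    by rewrite lt_neqAle start0 andbT; apply: contraTneq hy => <-; rewrite subr0 normr1 ltxx.
  rewrite ger0_norm ?subr_ge0// ltrBlDr ltrDl y0 /=.
  apply: (@le_lt_trans _ _ 2^-1); last by lra.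
  apply/(pos_ball_distP _ _ _ Hc (slopeB y)); apply: filterS2 (slopeB y) (rv_cst 2^-1).
  by move=> t [_ /andP[? ?]] ->; rewrite ler_norml; apply/andP; split; lra.
by move=> y z /K ny /K nz; exists n.
Qed.

(** If the second coordinate u of x is not 0, take disjoint idempotents e and f
    where u exceeds half its norm. The balls around (0, e) and (0, f) both meet the
    ball around x but not each other: a point (a, v) of both would have a < 1 and
    |v| < 1. *)
Let P_uniq x : P x -> x = sval x1.
Proof.
move=> Px; apply: contrapT => nx.
have u0 : slope x <> 0.
  move=> t0; apply: nx; apply: sphere_eq; rewrite ?slope_x1// start_x1.
  by apply: sph_lt'; rewrite t0 Linf_norm0.
have [e [f [ie jf e0 f0 ef]]] := idem_split _ (pos_ball_ge0 _ (slopeB x)) u0.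
have h01 : 0 <= (2^-1 : R) <= 1 by lra.
have z01 : 0 <= (0 : R) <= 1 by lra.
pose s := Linf_norm (slope x).
have s0 : 0 < s by rewrite lt_neqAle Linf_norm_ge0 andbT eq_sym; apply/eqP => /Linf_norm0_eq.
have s1 : s <= 1 by exact: pos_ball_norm.
have build g : idem g -> g <> 0 -> (AE t : R, rv g t = 1 -> s / 2 < rv (slope x) t) ->
    exists y, [/\ start y = 0, slope y = g & meet x y].
  move=> ig g0 gx; have Hg := idem_pos_ball _ ig.
  have [y [hy ty]] := sphere_norm1 _ _ z01 Hg (idem_norm _ ig g0).
  exists y; split => //.
  (* The point (1/2, w) with w = 1 on g and 1/2 elsewhere lies in both balls. *)
  have [||w Hw Ew] := @pos_ball_exists R (fun t => 2^-1 + 2^-1 * rv g t).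
  - apply: measurable_funD; first exact: measurable_cst.
    by apply: measurable_funM; [exact: measurable_cst|exact: measurable_rv].
  - by apply: filterS Hg => t [_ /andP[? ?]]; apply/andP; split; lra.
  have nw : Linf_norm w = 1.
    apply: (norm_eq1_cut w g 1) => //; first exact: idem_norm.
    by apply: filterS2 Ew Hg => t -> [_ /andP[? ?]]; left; lra.
  have [n [hn tn]] := sphere_norm1 _ _ h01 Hw nw.
  exists n; rewrite /D !gt_max hn tn hy ty; split; apply/andP; split.
  - exact: half_dist_lt1.
  - apply: (@le_lt_trans _ _ (1 - s / 2)); last exact: onem_half_lt1.
    apply/(pos_ball_distP _ _ _ Hw (slopeB x)); apply: filterS4 Ew ig gx (slopeB x).
    move=> t -> [_ [] gt]; rewrite gt => xt [_ /andP[? ?]].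
      exact: half_dist_le.
    by apply: unit_dist_le => //; exact: xt.
  - by rewrite subr0 ger0_norm ?invr_ge0//; exact: half_lt1.
  - apply: (@le_lt_trans _ _ 2^-1); last exact: half_lt1.
    apply/(pos_ball_distP _ _ _ Hw Hg); apply: filterS2 Ew ig => t -> [_ gt].
    exact: half_dist_half.
have [|y [hy ty my]] := build e ie e0.
  by apply: filterS ef => t [_ H] e1; apply: H; left.
have [|z [hz tz mz]] := build f jf f0.
  by apply: filterS ef => t [_ H] e1; apply: H; right.
have [n []] := Px _ _ my mz; rewrite /D !gt_max hy hz ty tz !subr0 ger0_norm//.
move=> /andP[hn de] /andP[_ df].
have nn := sph_lt _ hn.
have : Linf_norm (slope n) <= Num.max (Linf_norm (slope n - e)) (Linf_norm (slope n - f)).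
  apply/(ge0_norm_leP _ _ (pos_ball_ge0 _ (slopeB n))).
  have de' := (pos_ball_distP _ _ _ (slopeB n) (idem_pos_ball _ ie)).1 (lexx _).
  have df' := (pos_ball_distP _ _ _ (slopeB n) (idem_pos_ball _ jf)).1 (lexx _).
  apply: filterS4 de' df' ef (slopeB n) => t et ft [[] E _] [_ /andP[n0 _]].
    by move: et; rewrite E subr0 ger0_norm// le_max => ->.
  by move: ft; rewrite E subr0 ger0_norm// le_max => ->; rewrite orbT.
by rewrite nn leNgt gt_max de df.
Qed.

Let fix_x1 Delta : sup_sphere_isometry Delta -> Delta (sval x1) = sval x1.
Proof.
move=> HD; apply: P_uniq => y z; have [sur _] := HD.
have [y' <-] := sur y; have [z' <-] := sur z.
have meetE (c d : S) : meet (Delta c) (Delta d) <-> meet c d.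
  split=> -[n [n1 n2]].
    by have [m mn] := sur n; exists m; split; rewrite -(D_pres _ _ _ HD) mn.
  by exists (Delta n); split; rewrite D_pres.
by move=> /meetE my /meetE mz; apply/meetE; exact: P_x1.
Qed.

(** The points (1, u) with |u| < 1 are those at distance less than 1 from (1, 0);
    the case |u| = 1 follows by approximation. *)
Let start1_pres Delta x : sup_sphere_isometry Delta -> start x = 1 -> start (Delta x) = 1.
Proof.
move=> HD hx.
have small y : start y = 1 -> Linf_norm (slope y) < 1 -> start (Delta y) = 1.
  move=> hy ty; apply: sph_lt'.
  have : D (Delta y) (sval x1) < 1.
    by rewrite -(fix_x1 _ HD) D_pres// D_x1 hy subrr gt_max ltr01.
  by rewrite D_x1 gt_max => /andP[].
apply/eqP; rewrite eq_le start1 /=; apply/ler_addgt0Pr => e e0.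
pose t : R := Num.max 0 (1 - e).
have t01 : 0 <= t <= 1 by rewrite /t le_max lexx /= ge_max ler01 lerBlDr lerDl ltW.
have Ht := pos_ball_cstM _ _ t01 (slopeB x).
have Et := rv_cstM _ _ t01 (slopeB x).
have [y [hy ty]] := sphere_start1 _ Ht.
have ny : Linf_norm (slope y) < 1.
  rewrite ty; apply: (@le_lt_trans _ _ t); last by rewrite /t gt_max ltr01 ltrBlDr ltrDl.
  apply/(ge0_norm_leP _ _ (pos_ball_ge0 _ Ht)); apply: filterS2 Et (slopeB x) => s -> [_ /andP[_ s1]].
  by rewrite ler_piMr//; case/andP: t01.
have dxy : D x y <= e.
  rewrite /D hx hy subrr normr0 ge_max (ltW e0) ty /=.
  apply/(pos_ball_distP _ _ _ (slopeB x) Ht); apply: filterS2 Et (slopeB x) => s -> [_ /andP[s0 s1]].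
  have t1 : 1 - e <= t by rewrite /t le_max lexx orbT.
  have /andP[_ t2] := t01.
  exact: mul_dist_le.
have : `|start (Delta x) - start (Delta y)| <= e.
  by apply: le_trans dxy; rewrite -(D_pres Delta x y HD) le_max lexx.
by rewrite (small _ hy ny) distrC ger0_norm ?subr_ge0// lerBlDl.
Qed.

Section Reduction.
Variable Delta : S -> S.
Hypothesis HD : sup_sphere_isometry Delta.

Let inverse : exists2 Eps : S -> S, sup_sphere_isometry Eps & cancel Delta Eps.
Proof.
have [sur iso] := HD.
pose Eps y := sval (cid (sur y)).
have K2 : cancel Eps Delta by move=> y; exact: (svalP (cid (sur y))).
have inj : injective Delta.
  move=> x y E; apply: D_eq0; rewrite -(D_pres Delta)// E /D !subrr normr0 Linf_norm0.
  by rewrite maxxx.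
have K1 : cancel Delta Eps by move=> x; apply: inj; rewrite K2.
exists Eps => //; split; first by move=> y; exists (Delta y).
by move=> x y; rewrite -iso !K2.
Qed.

Let start1_iff x : start (Delta x) = 1 <-> start x = 1.
Proof.
split=> h; last exact: start1_pres.
have [Eps HE K] := inverse.
by rewrite -(K x); exact: start1_pres.
Qed.

(** Second coordinate of the image of (1, u). *)
Let Phi u := xget 0 [set w | exists x, [/\ start x = 1, slope x = u & w = slope (Delta x)]].

Let PhiE x : start x = 1 -> Phi (slope x) = slope (Delta x).
Proof.
move=> hx.
have [y [hy ty Ew]] := @xgetPex _ 0
  [set w | exists y, [/\ start y = 1, slope y = slope x & w = slope (Delta y)]]
  (ex_intro _ _ (ex_intro _ x (And3 hx erefl erefl))).
rewrite /Phi Ew; congr (slope (Delta _)); apply: sphere_eq => //.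
by rewrite hx hy.
Qed.

Let Phi_ball : ball_isometry Phi.
Proof.
have [sur _] := HD.
split.
- by move=> u /sphere_start1[x [hx <-]]; rewrite PhiE.
- move=> v /sphere_start1[y [hy <-]]; have [x xy] := sur y.
  have hx : start x = 1 by apply/start1_iff; rewrite xy.
  by exists (slope x) => //; rewrite PhiE// xy.
- move=> u v /sphere_start1[x [hx <-]] /sphere_start1[y [hy <-]]; rewrite (PhiE _ hx) (PhiE _ hy).
  have := D_pres _ x y HD.
  rewrite /D ((start1_iff x).2 hx) ((start1_iff y).2 hy) hx hy subrr normr0.
  by rewrite !max_r// Linf_norm_ge0.
- by rewrite -{1}slope_x1 PhiE// fix_x1.
Qed.

Let PB u : pos_ball u -> pos_ball (Phi u). Proof. by case: Phi_ball => H *; exact: H. Qed.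
Let Pd u v : pos_ball u -> pos_ball v -> Linf_norm (Phi u - Phi v) = Linf_norm (u - v).
Proof. by case: Phi_ball => _ _ H *; exact: H. Qed.
Let Pnorm u : pos_ball u -> Linf_norm (Phi u) = Linf_norm u.
Proof.
move=> Hu; have [_ _ _ P0] := Phi_ball.
by rewrite -[Phi u]subr0 -[X in _ - X]P0 Pd ?subr0//; exact: pos_ball0.
Qed.

(** Comparison with the points (1, w). *)
Let dist_top x w : pos_ball w ->
  Num.max (1 - start (Delta x)) (Linf_norm (slope (Delta x) - Phi w)) =
  Num.max (1 - start x) (Linf_norm (slope x - w)).
Proof.
move=> /sphere_start1[y [hy <-]]; rewrite (PhiE _ hy).
have := D_pres _ x y HD; rewrite /D ((start1_iff y).2 hy) hy.
by rewrite ![`|_ - 1|]distrC !ger0_norm ?subr_ge0.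
Qed.

Let start_pres x : start (Delta x) = start x.
Proof.
have [_ Ps _ _] := Phi_ball.
apply/eqP; rewrite eq_le; apply/andP; split; rewrite -(lerD2l (-1)) -lerN2 !opprD !opprK.
  have [w Hw Ew] := Ps _ (slopeB (Delta x)).
  have := dist_top x _ Hw; rewrite Ew subrr Linf_norm0 max_l ?subr_ge0// => ->.
  by rewrite le_max lexx.
have := dist_top x _ (slopeB x); rewrite subrr Linf_norm0 [RHS]max_l ?subr_ge0// => <-.
by rewrite le_max lexx.
Qed.

(** For a >= 1/2, distances to the points (1, w) determine which balls of radius 1/2
    contain u. *)
Let slope_upper x : 2^-1 <= start x -> slope (Delta x) = Phi (slope x).
Proof.
move=> hx; have [h1|h1] := eqVneq (start x) 1; first by rewrite PhiE.
have {}h1 : start x < 1 by rewrite lt_neqAle h1 start1.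
have nx := sph_lt _ h1; have nDx : Linf_norm (slope (Delta x)) = 1 by apply: sph_lt; rewrite start_pres.
apply: unit_dist_eq; [exact: slopeB|exact: PB|by []|by rewrite Pnorm|].
have [_ Ps _ _] := Phi_ball.
move=> _ /Ps[w Hw <-] _; rewrite Pd//.
have E := dist_top x _ Hw; rewrite start_pres in E.
have h2 : 1 - start x <= 2^-1 by rewrite lerBlDr -lerBlDl; move: hx; apply: le_trans; lra.
have K a : (a <= 2^-1) = (Num.max (1 - start x) a <= 2^-1) by rewrite ge_max h2.
by rewrite K E -K.
Qed.

(** For a < 1/2, the same holds with the points (1/2, w), already known. *)
Let slope_lower x : start x < 2^-1 -> slope (Delta x) = Phi (slope x).
Proof.
move=> hx.
have h1 : start x < 1 by apply: lt_trans hx _; lra.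
have nx := sph_lt _ h1; have nDx : Linf_norm (slope (Delta x)) = 1 by apply: sph_lt; rewrite start_pres.
apply: unit_dist_eq; [exact: slopeB|exact: PB|by []|by rewrite Pnorm|].
have [_ Ps _ _] := Phi_ball.
move=> _ /Ps[w Hw <-]; rewrite Pnorm// => nw; rewrite Pd//.
have h01 : 0 <= (2^-1 : R) <= 1 by lra.
have [y [hy ty]] := sphere_norm1 _ _ h01 Hw nw.
have hy2 : 2^-1 <= start y by rewrite hy.
have := D_pres _ x y HD; rewrite /D !start_pres (slope_upper _ hy2) hy ty => E.
have h2 : `|start x - 2^-1| <= 2^-1.
  by have := start0 x; move: (start x) hx => h ? ?; rewrite ler_norml; apply/andP; split; lra.
have K a : (a <= 2^-1) = (Num.max `|start x - 2^-1| a <= 2^-1) by rewrite ge_max h2.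
by rewrite K E -K.
Qed.

Lemma infinite_sphere_reduction : exists2 Phi : L -> L, ball_isometry Phi & forall x,
  [/\ start (Delta x) = start x, slope (Delta x) = Phi (slope x) & pos_ball (slope x)].
Proof.
exists Phi => // x; split=> //.
by have [/slope_upper|/slope_lower] := leP 2^-1 (start x).
Qed.
End Reduction.
End InfiniteExponent.

(** * The extension theorem *)

Lemma sphere_reduction {R : realType} (p : \bar R) (hp : (1 <= p)%E)
    (Delta : pos_sphere p -> pos_sphere p)
    (Delta_surj : forall g : pos_sphere p, exists f : pos_sphere p, Delta f = g)
    (Delta_isom : forall f g : pos_sphere p,
      sigma_norm p (val (Delta f) - val (Delta g)) =
      sigma_norm p (val f - val g)) :
  exists2 Phi : Linf R -> Linf R, ball_isometry Phi & forall x,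
    [/\ start p (Delta x) = start p x, slope p (Delta x) = Phi (slope p x) & pos_ball (slope p x)].
Proof.
case: p hp Delta Delta_surj Delta_isom => [r| |] hp Delta sur iso //.
- by apply: finite_sphere_reduction => //; rewrite lee_fin in hp.
- by apply: infinite_sphere_reduction; split.
Qed.

Theorem theorem1p2 (R : realType) (p : \bar R) (hp : (1 <= p)%E)
    (Delta : pos_sphere p -> pos_sphere p)
    (Delta_surj : forall g : pos_sphere p, exists f : pos_sphere p, Delta f = g)
    (Delta_isom : forall f g : pos_sphere p,
      sigma_norm p (val (Delta f) - val (Delta g)) =
      sigma_norm p (val f - val g)) :
  exists T : Lip R -> Lip R,
    [/\ linear T,
        (forall g : Lip R, exists f : Lip R, T f = g),
        (forall f g : Lip R, sigma_norm p (T f - T g) = sigma_norm p (f - g)),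
        (forall f : pos_sphere p, T (val f) = val (Delta f)) &
        exists Lambda : Linf R -> Linf R,
          [/\ isometric_star_isomorphism Lambda,
              (forall (f : Lip R) (t : I01 R),
                T f t = f (I01_0 R)
                        + Cintegral_from0 (val t) (repr (Lambda (Lip_deriv f)))) &
              exists tau : continuousType (max_ideal_space R) (max_ideal_space R),
                homeomorphism tau /\
                (forall u : Linf R, Lambda u = gelfand_inv (gelfand u \o tau))]].
Proof.
have [Phi HPhi HDelta] := sphere_reduction _ hp _ Delta_surj Delta_isom.
have [Lam HLam LamE] := ball_isometry_extend _ HPhi.
have [[Lin K1 K2] lin mult _ isom] := HLam.
pose T (f : Lip R) : Lip R := Iprim (f (I01_0 R)) (Lam (Lip_deriv f)).
have T0 f : T f (I01_0 R) = f (I01_0 R) by exact: Iprim_at0.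
have T1 f : Lip_deriv (T f) = Lam (Lip_deriv f) by exact: Lip_deriv_Iprim.
have Tlin : linear T.
  move=> z f g; apply: Lip_eqP; last first.
    by rewrite T1 !Lip_deriv_linear !T1 lin.
  have E (a b : Lip R) : (z *: a + b) (I01_0 R) = z * a (I01_0 R) + b (I01_0 R) by [].
  by rewrite T0 !E !T0.
exists T; split; first exact: Tlin.
- move=> g; exists (Iprim (g (I01_0 R)) (Lin (Lip_deriv g))).
  by apply: Lip_eqP; rewrite ?T0 ?Iprim_at0// T1 Lip_deriv_Iprim K2.
- move=> f g; have -> : T f - T g = T (f - g).
    by have := Tlin (-1) g f; rewrite !scaleN1r (addrC f) => ->; rewrite addrC.
  by rewrite !sigma_normE T0 T1 isom.
- move=> x; have [h t tB] := HDelta x; apply: Lip_eqP.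
    rewrite T0; have [_ -> _ _] := sphereP _ x; have [_ -> _ _] := sphereP _ (Delta x).
    by rewrite h.
  by rewrite T1 [RHS]t; exact: LamE.
- exists Lam; split => //.
  exact: gelfand_star_isomorphism.
Qed.
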